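(* Let $T$ be a theory extending $\Sigma^1_1\text{-}\mathsf{AC}_0^{-}$ and let $Q(\overline R)$ be a generalized quantifier. Then: (1) If $Q$ is Henkin upward independent relative to $T$, then $Q$ is $\Sigma^1_1$-definable relative to $T$. (2) If $Q$ is Henkin downward independent relative to $T$, then $Q$ is $\Pi^1_1$-definable relative to $T$. (3) If $Q$ is Henkin domain independent relative to $T$, then $Q$ is $\Delta^1_1$-definable relative to $T$.
   Context: Language: second-order logic with individual variables and, for each $n\ge 1$, $n$-ary relation variables, identity, and atomic formulas $R\overline x$. A signature may add individual constant symbols $c$ and $n$-ary relation symbols $C$ (used as predicates in atomic formulas $C\overline x$). A formula is first-order if it has no second-order quantifiers (free second-order variables are allowed); it is $\Sigma^1_1$ (resp. $\Pi^1_1$) if it is of the form $\exists R_1\cdots R_\ell\,\varphi$ (resp. $\forall R_1\cdots R_\ell\,\varphi$) with $\varphi$ first-order. Henkin model: $\mathcal A=(A,S_1[A],S_2[A],\ldots)$ with $A\neq\emptyset$ and $\emptyset\neq S_n[A]\subseteq P(A^n)$; individual variables range over $A$, $n$-ary relation variables over $S_n[A]$; $R\overline a$ is interpreted as $\overline a\in R$; $c^{\mathcal A}\in A$ and $C^{\mathcal A}\subseteq A^n$. Provability from a theory $T$ is many-sorted first-order provability, equivalently truth in all Henkin models of $T$. $\Sigma^1_1\text{-}\mathsf{AC}_0^{-}$: extensionality axioms ($R=S\leftrightarrow\forall\overline x(R\overline x\leftrightarrow S\overline x)$ for each arity); comprehension $\exists R\,\forall\overline x\,(R\overline x\leftrightarrow\varphi(\overline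 x))$ for all first-order $\varphi$ of the signature (parameters allowed, $R$ not free in $\varphi$); and the schema $\forall\overline x\,\exists R\,\varphi(\overline x,R)\rightarrow\exists R'\,\forall\overline x\,\varphi(\overline x,R'[\overline x])$ for $\Sigma^1_1$ formulas $\varphi$ (parameters allowed), where $R$ is $m$-ary, $\overline x$ has length $n$, $R'$ is $(n+m)$-ary and $R'[\overline x]=\{\overline y: R'\overline x\,\overline y\}$. A generalized quantifier is a formula $Q(R_1,\ldots,R_\ell)$ whose only free variables are the displayed second-order variables, of arities $\overline n=(n_1,\ldots,n_\ell)$; write $S_{\overline n}[A]=S_{n_1}[A]\times\cdots\times S_{n_\ell}[A]$. $\mathcal A$ is a substructure of $\mathcal B$ (both Henkin models) if $A\subseteq B$, $S_n[A]\subseteq S_n[B]$ for all $n\ge1$, $c^{\mathcal B}=c^{\mathcal A}$ for individual constants, and $C^{\mathcal B}\cap A^n=C^{\mathcal A}$ for $n$-ary relation symbols. $Q$ is Henkin upward independent relative to $T$ if for all Henkin models $\mathcal A,\mathcal B$ of $T$ with $\mathcal A$ a substructure of $\mathcal B$ and all $\overline R\in S_{\overline n}[A]$: $\mathcal A\models Q(\overline R)\Rightarrow\mathcal B\models Q(\overline R)$. Henkin downward independent: the reverse implication. Henkin domain independent: both. $Q$ is $\Sigma^1_1$-definable (resp. $\Pi^1_1$-definable) relative to $T$ if there is a $\Sigma^1_1$ (resp. $\Pi^1_1$) formula $\Phi(\overline R)$ with exactly the displayed free variables such that $T$ proves $\forall\overline R\,(Q(\overline R)\leftrightarrow\Phi(\overline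 R))$; it is $\Delta^1_1$-definable relative to $T$ if it is both. *)

(* Defs.v *)
From mathcomp Require Import all_boot.
From mathcomp Require Import boolp classical_sets.

Set Implicit Arguments.
Unset Strict Implicit.
Unset Printing Implicit Defensive.

Local Open Scope classical_set_scope.

(* Arities of relation variables and symbols are at least 1; throughout, the
   index n stands for the arity n.+1. *)

Record signature := Signature {
  const : Type;
  rsym : nat -> Type   (* rsym n: relation symbols of arity n.+1 *)
}.

(* Individual variables are named by x : nat, and relation variables of arity
   n.+1 by k : nat, i.e. a relation variable is a pair (n, k) : nat * nat. *)

Inductive term (L : signature) :=
| TVar of nat
| TCst of const L.

Arguments TVar {L} _.

Inductive form (L : signature) :=
| FEq of term L & term L
| FREq (n : nat) of nat & nat
| FRel (n : nat) of nat & n.+1.-tuple (term L)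
| FSym (n : nat) of rsym L n & n.+1.-tuple (term L)
| FNot of form L
| FAnd of form L & form L
| FEx of nat & form L
| FExR (n : nat) of nat & form L.

Arguments FREq {L} n _ _.
Arguments FExR {L} n _ _.

Definition FOr L (p q : form L) := FNot (FAnd (FNot p) (FNot q)).
Definition FImp L (p q : form L) := FNot (FAnd p (FNot q)).
Definition FIff L (p q : form L) := FAnd (FImp p q) (FImp q p).
Definition FAll L (x : nat) (p : form L) := FNot (FEx x (FNot p)).
Definition FAllR L (n k : nat) (p : form L) := FNot (FExR n k (FNot p)).

Definition FAlls L (xs : seq nat) (p : form L) : form L :=
  foldr (@FAll L) p xs.
Definition FExRs L (Rs : seq (nat * nat)) (p : form L) : form L :=
  foldr (fun X => FExR X.1 X.2) p Rs.
Definition FAllRs L (Rs : seq (nat * nat)) (p : form L) : form L :=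
  foldr (fun X => FAllR X.1 X.2) p Rs.

(* R x1 ... xn for individual variables x1, ..., xn *)
Definition FRelv L (n k : nat) (xs : n.+1.-tuple nat) : form L :=
  FRel k (map_tuple (@TVar L) xs).

Definition term_free L (x : nat) (t : term L) : bool :=
  if t is TVar y then y == x else false.

Fixpoint free L (x : nat) (p : form L) : bool :=
  match p with
  | FEq s t => term_free x s || term_free x t
  | FREq _ _ _ => false
  | FRel _ _ ts => has (term_free x) ts
  | FSym _ _ ts => has (term_free x) ts
  | FNot q => free x q
  | FAnd q r => free x q || free x r
  | FEx y q => (y != x) && free x q
  | FExR _ _ q => free x q
  end.

Fixpoint freeR L (X : nat * nat) (p : form L) : bool :=
  match p with
  | FEq _ _ => false
  | FREq n k l => ((n, k) == X) || ((n, l) == X)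
  | FRel n k _ => (n, k) == X
  | FSym _ _ _ => false
  | FNot q => freeR X q
  | FAnd q r => freeR X q || freeR X r
  | FEx _ q => freeR X q
  | FExR n k q => ((n, k) != X) && freeR X q
  end.

Definition sentence L (p : form L) : Prop :=
  (forall x, ~~ free x p) /\ (forall X, ~~ freeR X p).

Fixpoint first_order L (p : form L) : bool :=
  match p with
  | FNot q => first_order q
  | FAnd q r => first_order q && first_order r
  | FEx _ q => first_order q
  | FExR _ _ _ => false
  | _ => true
  end.

Definition Sigma11 L (p : form L) : Prop :=
  exists Rs q, first_order q /\ p = FExRs Rs q.

Definition Pi11 L (p : form L) : Prop :=
  exists Rs q, first_order q /\ p = FAllRs Rs q.

Definition power U (D : set U) (n : nat) : set (n.-tuple U) :=
  [set t | forall i, D (tnth t i)].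

Arguments power {U} D n _.

(* The domain is a subset of an ambient type U, so that "A is a substructure
   of B" can be stated with literal inclusions for models over the same U. *)
Record henkin (L : signature) (U : Type) := Henkin {
  dom : set U;
  dom_neq0 : dom !=set0;
  rels : forall n, set (set (n.+1.-tuple U));
  rels_neq0 : forall n, @rels n !=set0;
  rels_sub : forall n (R : set (n.+1.-tuple U)), rels R -> R `<=` power dom n.+1;
  cstI : const L -> U;
  cstI_dom : forall c, dom (cstI c);
  symI : forall n, rsym L n -> set (n.+1.-tuple U);
  symI_sub : forall n (C : rsym L n), symI C `<=` power dom n.+1
}.

Record assignment (U : Type) := Assignment {
  ival : nat -> U;
  rval : forall n, nat -> set (n.+1.-tuple U)
}.

Arguments rels {L U} _ n _.
Arguments rval {U} _ n _ _.

Definition assignment_in L U (A : henkin L U) (e : assignment U) : Prop :=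
  (forall x, dom A (ival e x)) /\ (forall n k, rels A n (rval e n k)).

Definition upd U (e : assignment U) (x : nat) (a : U) : assignment U :=
  Assignment (fun y => if y == x then a else ival e y) (rval e).

Definition updR U (e : assignment U) (n k : nat)
    (R : set (n.+1.-tuple U)) : assignment U :=
  Assignment (ival e)
    (dfwith (rval e) (fun j => if j == k then R else rval e n j)).

Definition tval L U (A : henkin L U) (e : assignment U) (t : term L) : U :=
  match t with TVar x => ival e x | TCst c => cstI A c end.

Fixpoint sat L U (A : henkin L U) (e : assignment U) (p : form L) : Prop :=
  match p with
  | FEq s t => tval A e s = tval A e t
  | FREq n k l => rval e n k = rval e n l
  | FRel n k ts => rval e n k (map_tuple (tval A e) ts)
  | FSym n C ts => symI A C (map_tuple (tval A e) ts)
  | FNot q => ~ sat A e q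
  | FAnd q r => sat A e q /\ sat A e r
  | FEx x q => exists2 a, dom A a & sat A (upd e x a) q
  | FExR n k q => exists2 R, rels A n R & sat A (updR e k R) q
  end.

Definition valid L U (A : henkin L U) (p : form L) : Prop :=
  forall e, assignment_in A e -> sat A e p.

Definition model L U (A : henkin L U) (T : set (form L)) : Prop :=
  forall p, T p -> valid A p.

(* Provability from T, taken as truth in all Henkin models of T; a formula
   with free variables is identified with its universal closure. *)
Definition proves L (T : set (form L)) (p : form L) : Prop :=
  forall U (A : henkin L U), model A T -> valid A p.

(* In the choice schema, R is the relation variable (m, k), and R' is the
   variable k' of arity n + m.+1, where n = n'.+1 is the length of xs.  The
   formula phi(x, R'[x]) is expressed by the contextual definition of R'[x]:
   there is R such that R y <-> R' x y for all y, and phi(x, R). *)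
Inductive Sigma11_AC0 (L : signature) : form L -> Prop :=
| ax_ext n k l (xs : n.+1.-tuple nat) :
    uniq xs ->
    Sigma11_AC0 (FIff (FREq n k l)
                      (FAlls xs (FIff (FRelv L k xs) (FRelv L l xs))))
| ax_comp n k (xs : n.+1.-tuple nat) (phi : form L) :
    uniq xs -> first_order phi -> ~~ freeR (n, k) phi ->
    Sigma11_AC0 (FExR n k (FAlls xs (FIff (FRelv L k xs) phi)))
| ax_choice n' m k k' (xs : n'.+1.-tuple nat) (ys : m.+1.-tuple nat)
    (phi : form L) :
    uniq (xs ++ ys) -> Sigma11 phi -> ~~ freeR (n' + m.+1, k') phi ->
    Sigma11_AC0
      (FImp (FAlls xs (FExR m k phi))
            (FExR (n' + m.+1) k'
               (FAlls xs (FExR m k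
                  (FAnd (FAlls ys (FIff (FRelv L k ys)
                           (@FRelv L (n' + m.+1) k' (cat_tuple xs ys))))
                        phi))))).

Definition theory L (T : set (form L)) : Prop := forall p, T p -> sentence p.

Definition extends_Sigma11_AC0 L (T : set (form L)) : Prop :=
  forall p, Sigma11_AC0 p -> proves T p.

Definition generalized_quantifier L (Rs : seq (nat * nat)) (Q : form L) :
    Prop :=
  [/\ uniq Rs, (forall x, ~~ free x Q) & (forall X, freeR X Q -> X \in Rs)].

Definition substructure L U (A B : henkin L U) : Prop :=
  [/\ dom A `<=` dom B,
      (forall n, rels A n `<=` rels B n),
      (forall c, cstI B c = cstI A c) &
      (forall n (C : rsym L n), symI B C `&` power (dom A) n.+1 = symI A C)].

(* An assignment into A provides in particular an arbitrary tuple of values in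
   S[A] for the free relation variables of Q; its other values are irrelevant
   to Q, and it is also an assignment into B. *)
Definition upward_independent L (T : set (form L)) (Q : form L) : Prop :=
  forall U (A B : henkin L U), model A T -> model B T -> substructure A B ->
  forall e, assignment_in A e -> sat A e Q -> sat B e Q.

Definition downward_independent L (T : set (form L)) (Q : form L) : Prop :=
  forall U (A B : henkin L U), model A T -> model B T -> substructure A B ->
  forall e, assignment_in A e -> sat B e Q -> sat A e Q.

Definition domain_independent L (T : set (form L)) (Q : form L) : Prop :=
  upward_independent T Q /\ downward_independent T Q.

Definition definable_by L (K : form L -> Prop) (T : set (form L))
    (Rs : seq (nat * nat)) (Q : form L) : Prop :=
  exists Phi : form L,
    [/\ K Phi, (forall x, ~~ free x Phi),
        (forall X, freeR X Phi = (X \in Rs)) &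
        proves T (FAllRs Rs (FIff Q Phi))].

Definition Sigma11_definable L (T : set (form L)) (Rs : seq (nat * nat))
    (Q : form L) : Prop := definable_by (@Sigma11 L) T Rs Q.

Definition Pi11_definable L (T : set (form L)) (Rs : seq (nat * nat))
    (Q : form L) : Prop := definable_by (@Pi11 L) T Rs Q.

Definition Delta11_definable L (T : set (form L)) (Rs : seq (nat * nat))
    (Q : form L) : Prop := Sigma11_definable T Rs Q /\ Pi11_definable T Rs Q.

(* Main.v *)
(* The theorem holds because much less than full independence is needed: only
   substructures A of B with the same domain matter.  Modulo T, axiom of choice
   makes the Sigma^1_1 formulas closed under conjunction, disjunction and all
   the quantifiers except the universal relation quantifiers.  If Q is not
   equivalent over T to a Sigma^1_1 formula, no Sigma^1_1 formula separates Q
   from its negation, and a Henkin construction that keeps a pair of predicates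
   inseparable by Sigma^1_1 formulas builds models A and B with the same domain
   and S_n[A] included in S_n[B], such that A satisfies Q and B does not: a
   witness of an existential individual quantifier in B is also an element of A,
   which is harmless because the separating formulas are closed under universal
   individual quantifiers.  The construction is countable and takes care of
   finitely many axioms of T; an ultraproduct of the pairs takes care of all of
   them, so that Q is not upward independent.  The downward case is the upward
   case for the negation of Q. *)

From HB Require Import structures.
From mathcomp Require Import all_boot.
From mathcomp Require Import boolp classical_sets filter.
Require Import Defs.

Set Implicit Arguments.
Unset Strict Implicit.
Unset Printing Implicit Defensive.

Local Open Scope classical_set_scope.

(** * Satisfaction and variables *)

(** The two models share their names of individuals, which are natural numbers, so atomic facts
    about individuals and common relations must get the same answer on both sides. A first-order
    formula and its negation are both $\Sigma^1_1$; hence every first-order decision made for A can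
    be copied to B without creating a separation, and nothing has to be copied back. A universal
    relation quantifier would be called for by a relation witness of B that separating formulas can
    see. Such witnesses therefore get odd names, while separating formulas are read in B at the even
    names, which denote the relations of A. The signature and T may be uncountable, whereas a
    construction in countably many stages decides only countably many formulas; this is why finitely
    many axioms are treated at a time. Since provability is truth in all Henkin models, the stages
    are semantic predicates of finite support, and no proof calculus enters. *)

Section Coincidence.
Context (L : signature).
Implicit Types (p q : form L).

Lemma updR_same U (e : assignment U) n k R : rval (updR e (n := n) k R) n k = R.
Proof. by rewrite /= dfwith_in eqxx. Qed.

Lemma updR_other U (e : assignment U) n k R n' k' :
  (n', k') != (n, k) -> rval (updR e (n := n) k R) n' k' = rval e n' k'.
Proof.
move=> h /=; have [E|ne] := eqVneq n n'; last by rewrite dfwith_out.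
case: _ / E h => h; rewrite dfwith_in.
by have [kk|//] := eqVneq k' k; rewrite kk eqxx in h.
Qed.

Lemma assignment_eq U (e e' : assignment U) :
  ival e = ival e' -> (forall n k, rval e n k = rval e' n k) -> e = e'.
Proof.
case: e e' => i r [i' r'] /= -> h; congr Assignment.
by apply: functional_extensionality_dep => n; apply: funext => k; exact: h.
Qed.

Lemma upd_id U (e : assignment U) x : upd e x (ival e x) = e.
Proof.
by apply: assignment_eq => //=; apply: funext => y; case: eqP => // ->.
Qed.

Lemma upd_in U (A : henkin L U) e x a :
  assignment_in A e -> dom A a -> assignment_in A (upd e x a).
Proof. by case=> h1 h2 ha; split=> //= y; case: eqP. Qed.

Lemma updR_in U (A : henkin L U) e n k R :
  assignment_in A e -> rels A n R -> assignment_in A (updR e k R).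
Proof.
case=> h1 h2 ha; split=> // n' k'.
have [[-> ->]|ne] := eqVneq (n', k') (n, k); first by rewrite updR_same.
by rewrite updR_other.
Qed.

Lemma tval_eq U (A : henkin L U) e e' t :
  (forall x, term_free x t -> ival e x = ival e' x) -> tval A e t = tval A e' t.
Proof. by case: t => //= x h; apply: h. Qed.

Lemma tvals_eq U (A : henkin L U) e e' n (ts : n.-tuple (term L)) :
  (forall x, has (term_free x) ts -> ival e x = ival e' x) ->
  map_tuple (tval A e) ts = map_tuple (tval A e') ts.
Proof.
move=> h; apply: eq_from_tnth => i; rewrite !tnth_map; apply: tval_eq => x hx.
apply: h; apply/(has_nthP (tnth ts i)); exists i; first by rewrite size_tuple.
by rewrite -tnth_nth.
Qed.

Lemma sat_coincide U (A : henkin L U) p : forall e e',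
  (forall x, free x p -> ival e x = ival e' x) ->
  (forall n k, freeR (n, k) p -> rval e n k = rval e' n k) ->
  sat A e p -> sat A e' p.
Proof.
elim: p => [s t|n k l|n k ts|n C ts|q IH|q IHq r IHr|x q IH|n k q IH] e e' /= h1 h2.
- by rewrite !(@tval_eq _ A e e') // => x hx; apply: h1; rewrite hx ?orbT.
- by rewrite !h2 ?eqxx ?orbT.
- by rewrite h2 ?eqxx // (tvals_eq A h1).
- by rewrite (tvals_eq A h1).
- by apply: contra_not; apply: IH => [x hx|n k hk]; rewrite ?h1 ?h2.
- case=> hq hr; split.
    by apply: IHq hq => [x hx|n k hk]; rewrite ?h1 ?h2 // ?hx ?hk.
  by apply: IHr hr => [x hx|n k hk]; rewrite ?h1 ?h2 // ?hx ?hk ?orbT.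
- case=> a ha hs; exists a => //; apply: IH hs => //= y hy.
  by have [//|ne] := eqVneq y x; apply: h1; rewrite eq_sym ne.
- case=> R hR hs; exists R => //; apply: IH hs => // n' k' hk.
  have [[-> ->]|ne] := eqVneq (n', k') (n, k); first by rewrite !updR_same.
  by rewrite !updR_other // h2 // eq_sym ne.
Qed.

Definition tbound (t : term L) : nat := if t is TVar x then x.+1 else 0.

Definition tsbound (ts : seq (term L)) : nat := \max_(t <- ts) tbound t.

(* All arities and all names of the variables occurring in p are below
   bound p. *)
Fixpoint bound p : nat :=
  match p with
  | FEq s t => maxn (tbound s) (tbound t)
  | FREq n k l => maxn n.+1 (maxn k.+1 l.+1)
  | FRel n k ts => maxn (maxn n.+1 k.+1) (tsbound ts)
  | FSym _ _ ts => tsbound ts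
  | FNot q => bound q
  | FAnd q r => maxn (bound q) (bound r)
  | FEx x q => maxn x.+1 (bound q)
  | FExR n k q => maxn (maxn n.+1 k.+1) (bound q)
  end.

Lemma term_free_bound x t : term_free x t -> x < tbound t.
Proof. by case: t => //= y /eqP ->. Qed.

Lemma terms_free_bound x (ts : seq (term L)) :
  has (term_free x) ts -> x < tsbound ts.
Proof.
rewrite /tsbound; elim: ts => //= t ts IH; rewrite big_cons leq_max.
by case/orP => [/term_free_bound ->//|/IH ->]; rewrite orbT.
Qed.

Lemma free_bound x p : free x p -> x < bound p.
Proof.
elim: p => [s t|//|n k ts|n C ts|q IH|q IHq r IHr|y q IH|n k q IH] //=.
- by rewrite leq_max => /orP[] /term_free_bound ->; rewrite ?orbT.
- by move/terms_free_bound; rewrite !leq_max => ->; rewrite orbT.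
- exact: terms_free_bound.
- by rewrite leq_max => /orP[/IHq|/IHr] ->; rewrite ?orbT.
- by rewrite leq_max => /andP[_ /IH] ->; rewrite orbT.
- by rewrite !leq_max => /IH ->; rewrite orbT.
Qed.

Lemma freeR_bound n k p : freeR (n, k) p -> (n < bound p) && (k < bound p).
Proof.
elim: p => [//|n' k' l|n' k' ts|//|q IH|q IHq r IHr|y q IH|n' k' q IH] //=.
- by case/orP => /eqP[<- <-]; rewrite !leq_max !leqnn ?orbT.
- by move/eqP => [<- <-]; rewrite !leq_max !leqnn ?orbT.
- by rewrite !leq_max => /orP[/IHq|/IHr] /andP[-> ->]; rewrite ?orbT.
- by rewrite !leq_max => /IH /andP[-> ->]; rewrite !orbT.
- by rewrite !leq_max => /andP[_ /IH] /andP[-> ->]; rewrite !orbT.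
Qed.

Definition agree N U (e e' : assignment U) : Prop :=
  (forall x, x < N -> ival e x = ival e' x) /\
  (forall n k, n < N -> k < N -> rval e n k = rval e' n k).

Lemma agree_sym N U (e e' : assignment U) : agree N e e' -> agree N e' e.
Proof. by case=> h1 h2; split=> *; rewrite ?h1 ?h2. Qed.

Lemma agree_leq M N U (e e' : assignment U) : M <= N -> agree N e e' -> agree M e e'.
Proof.
by move=> le [h1 h2]; split=> [x hx|n k hn hk]; rewrite ?h1 ?h2 // (leq_trans _ le).
Qed.

Lemma agree_sat U (A : henkin L U) e e' p :
  agree (bound p) e e' -> sat A e p -> sat A e' p.
Proof.
case=> h1 h2; apply: sat_coincide => [x /free_bound/h1 //|n k /freeR_bound/andP[]].
exact: h2.
Qed.

Lemma sat_agree U (A : henkin L U) e e' p :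
  agree (bound p) e e' -> sat A e p <-> sat A e' p.
Proof. by move=> h; split; apply: agree_sat => //; exact: agree_sym. Qed.

Definition variant (Rs : seq (nat * nat)) U (e e' : assignment U) : Prop :=
  ival e = ival e' /\ (forall n k, (n, k) \notin Rs -> rval e n k = rval e' n k).

Lemma sat_FExRs U (A : henkin L U) e Rs q : assignment_in A e ->
  sat A e (FExRs Rs q) <->
  exists e', [/\ assignment_in A e', variant Rs e e' & sat A e' q].
Proof.
elim: Rs e => [|[n k] Rs IH] e he /=.
  split=> [h|[e' [_ [h1 h2] h]]]; first by exists e.
  by rewrite (_ : e = e') //; apply: assignment_eq => // n k; exact: h2.
split=> [[R hR /(IH _ (updR_in _ he hR)) [e' [he' [h1 h2] h]]]|[e' [he' [h1 h2] h]]].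
  exists e'; split=> //; split=> // n' k'; rewrite inE negb_or => /andP[ne hn].
  by rewrite -h2 // updR_other.
exists (rval e' n k); first by case: he'.
apply/IH; first by apply: updR_in => //; case: he'.
exists e'; split=> //; split=> // n' k' hn.
have [[-> ->]|ne] := eqVneq (n', k') (n, k); first by rewrite updR_same.
by rewrite updR_other // h2 // inE negb_or ne.
Qed.

Lemma sat_FAll U (A : henkin L U) e x p :
  sat A e (FAll x p) <-> forall a, dom A a -> sat A (upd e x a) p.
Proof.
split=> /= [h a ha|h [a ha]]; last by apply; exact: h.
by apply: contrapT => hn; apply: h; exists a.
Qed.

Lemma sat_FAnd U (A : henkin L U) e p q :
  sat A e (FAnd p q) <-> sat A e p /\ sat A e q.
Proof. by []. Qed.

Lemma sat_FExR U (A : henkin L U) e n k p :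
  sat A e (FExR n k p) <-> exists2 R, rels A n R & sat A (updR e k R) p.
Proof. by []. Qed.

Lemma sat_FImp U (A : henkin L U) e p q :
  sat A e (FImp p q) <-> (sat A e p -> sat A e q).
Proof.
split=> /= [h hp|h [hp]]; last by apply; exact: h.
by apply: contrapT => hn; apply: h.
Qed.

Lemma sat_FOr U (A : henkin L U) e p q :
  sat A e (FOr p q) <-> (sat A e p \/ sat A e q).
Proof.
split=> /= [h|h [hp hq]]; last by case: h.
by apply: contrapT => /not_orP.
Qed.

Lemma sat_FIff U (A : henkin L U) e p q :
  sat A e (FIff p q) <-> (sat A e p <-> sat A e q).
Proof.
split=> [[/sat_FImp h1 /sat_FImp h2] //|[h1 h2]].
by split; apply/sat_FImp.
Qed.

Definition iupd U (e : assignment U) (f : nat -> U) : assignment U :=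
  Assignment f (rval e).

Lemma sat_FAlls U (A : henkin L U) e (xs : seq nat) p :
  sat A e (FAlls xs p) <->
  forall f, (forall x, x \in xs -> dom A (f x)) -> (forall x, x \notin xs -> f x = ival e x) ->
    sat A (iupd e f) p.
Proof.
elim: xs e => [|x xs IH] e.
  split=> [h f _ hf|h]; last by have := h (ival e); case: e {h} => i r; apply.
  by have -> // : iupd e f = e; apply: assignment_eq => //=; apply: funext => y; exact: hf.
rewrite [FAlls _ _]/= sat_FAll; split=> h.
  move=> f hf1 hf2; have := h (f x) (hf1 _ (mem_head _ _)).
  move/IH; apply=> [y hy|y hy /=]; first by apply: hf1; rewrite inE hy orbT.
  by case: eqP => [->//|/eqP ne]; apply: hf2; rewrite inE negb_or ne.
move=> a ha; apply/IH => f hf1 hf2; apply: h => y.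
  have [hy _|hy] := boolP (y \in xs); first exact: hf1.
  by rewrite inE (negbTE hy) orbF => /eqP yx; rewrite hf2 //= yx eqxx.
by rewrite inE negb_or => /andP[ne hy]; rewrite hf2 //= (negbTE ne).
Qed.

Lemma sat_FAlls_tuple U (A : henkin L U) e n (xs : n.-tuple nat) p (P : n.-tuple U -> Prop) :
  uniq xs ->
  (forall f, (forall x, x \notin xs -> f x = ival e x) ->
     sat A (iupd e f) p <-> P (map_tuple f xs)) ->
  sat A e (FAlls xs p) <-> forall t, power (dom A) n t -> P t.
Proof.
move=> uxs hP; rewrite sat_FAlls; split=> [h t ht|h f hf1 hf2]; last first.
  by apply/(hP f hf2); apply: h => i; rewrite tnth_map; apply: hf1; exact: mem_tnth.
pose f x := if x \in xs then nth (ival e x) t (index x xs) else ival e x.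
have E : map_tuple f xs = t.
  apply: eq_from_tnth => i; rewrite tnth_map /f mem_tnth (tnth_nth 0)
    index_uniq ?size_tuple //.
  by rewrite -tnth_nth.
rewrite -E; apply/hP => [x hx|]; first by rewrite /f (negbTE hx).
apply: h => x hx; rewrite /f ?hx ?(negbTE hx) //.
have hi : index x xs < n by rewrite -{2}(size_tuple xs) index_mem.
by have := ht (Ordinal hi); rewrite (tnth_nth (ival e x)).
Qed.

Lemma tvals_vars U (A : henkin L U) e n (xs : n.-tuple nat) :
  map_tuple (tval A e) (map_tuple (@TVar L) xs) = map_tuple (ival e) xs.
Proof. by apply: eq_from_tnth => i; rewrite !tnth_map. Qed.

Lemma sat_FRelv U (A : henkin L U) e f n k (xs : n.+1.-tuple nat) :
  sat A (iupd e f) (FRelv L k xs) = rval e n k (map_tuple f xs).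
Proof. by rewrite /= tvals_vars. Qed.

Lemma power_ext U (A : henkin L U) n (R S : set (n.+1.-tuple U)) :
  rels A n R -> rels A n S ->
  (forall t, power (dom A) n.+1 t -> R t <-> S t) -> R = S.
Proof.
move=> hR hS h; apply/seteqP; split=> t ht; apply/h => //; exact: (rels_sub _ ht).
Qed.

(** Relation variables are going to be replaced by definable sets or by names, for which only
    membership is available, so relation equality is rewritten as coextensionality over the domain.
    The bound variables 0, ..., n capture nothing, as the matrix contains no other individual
    variables. *)
Fixpoint noeq p : form L :=
  match p with
  | FREq n k l => let xs := iota_tuple n.+1 0 in
                  FAlls xs (FIff (FRelv L k xs) (FRelv L l xs))
  | FNot q => FNot (noeq q)
  | FAnd q r => FAnd (noeq q) (noeq r)
  | FEx x q => FEx x (noeq q)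
  | FExR n k q => FExR n k (noeq q)
  | _ => p
  end.

Fixpoint eqfree p : bool :=
  match p with
  | FREq _ _ _ => false
  | FNot q => eqfree q
  | FAnd q r => eqfree q && eqfree r
  | FEx _ q => eqfree q
  | FExR _ _ q => eqfree q
  | _ => true
  end.

Lemma eqfree_FAlls xs p : eqfree (FAlls xs p) = eqfree p.
Proof. by elim: xs. Qed.

Lemma eqfree_noeq p : eqfree (noeq p).
Proof.
by elim: p => // [n k l|q IHq r IHr]; rewrite /= ?IHq // -/(FAlls _ _) eqfree_FAlls.
Qed.

Lemma first_order_FAlls xs p : first_order (FAlls xs p) = first_order p.
Proof. by elim: xs. Qed.

Lemma first_order_noeq p : first_order (noeq p) = first_order p.
Proof.
elim: p => // [n k l|q IHq r IHr]; rewrite /= ?IHq ?IHr //.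
by rewrite -/(FAlls _ _) first_order_FAlls.
Qed.

Lemma sat_noeq U (A : henkin L U) p e : assignment_in A e ->
  sat A e (noeq p) <-> sat A e p.
Proof.
elim: p e => [s t|n k l|n k ts|n C ts|q IH|q IHq r IHr|x q IH|n k q IH] e he //.
- rewrite (@sat_FAlls_tuple _ _ _ _ _ _ (fun t => rval e n k t <-> rval e n l t));
    [|exact: iota_uniq|by move=> f _; rewrite sat_FIff /= !tvals_vars].
  split=> [h|/= -> //]; case: he => _ he.
  exact: power_ext (he _ _) (he _ _) h.
- by have := IH e he => /=; tauto.
- by have := IHq e he; have := IHr e he => /=; tauto.
- by split=> -[a ha h]; exists a => //; apply/(IH _ (upd_in x he ha)).
- by split=> -[a ha h]; exists a => //; apply/(IH _ (updR_in k he ha)).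
Qed.

End Coincidence.

(** * Substitution *)

Section Substitution.
Context (L : signature).
Implicit Types (p q : form L).

Lemma variant_agree (Rs : seq (nat * nat)) N U (e e' : assignment U) :
  (forall X, X \in Rs -> N <= X.2) -> variant Rs e e' -> agree N e e'.
Proof.
move=> h [h1 h2]; split=> [x _|n k _ hk]; first by rewrite h1.
by apply: h2; apply/negP => /h /=; rewrite leqNgt hk.
Qed.

Lemma FExRs_bound Rs q X : X \in Rs -> X.2 < bound (FExRs Rs q).
Proof.
elim: Rs => //= Y Rs IH; rewrite inE => /orP[/eqP <-|/IH h].
  by rewrite !leq_max leqnn orbT.
by rewrite leq_max h orbT.
Qed.

Definition tren (r : nat -> nat) (t : term L) : term L :=
  if t is TVar x then TVar (r x) else t.

Lemma tvals_ren U (A : henkin L U) e r V n (ts : n.-tuple (term L)) :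
  map_tuple (tval A e) (map_tuple (tren r) ts) =
  map_tuple (tval A (Assignment (ival e \o r) V)) ts.
Proof. by apply: eq_from_tnth => i; rewrite !tnth_map; case: (tnth ts i). Qed.

Lemma first_order_subst_eqfree M
    (V : forall U, assignment U -> forall n, nat -> set (n.+1.-tuple U))
    (Vloc : forall U e y a n k, M <= y -> V U (upd e y a) n k = V U e n k)
    (Vdef : forall n k (ts : n.+1.-tuple (term L)), exists2 p, first_order p &
       forall U (A : henkin L U) e, assignment_in A e ->
       sat A e p <-> V U e n k (map_tuple (tval A e) ts)) q :
  first_order q -> eqfree q -> forall r, exists2 p, first_order p &
    forall U (A : henkin L U) e, assignment_in A e ->
    sat A e p <-> sat A (Assignment (ival e \o r) (V U e)) q.
Proof.
elim: q => [s t|//|n k ts|n C ts|q IH|q IHq q' IHq'|x q IH|//] /= fo ef r.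
- exists (FEq (tren r s) (tren r t)) => // U A e _ /=.
  by case: s; case: t.
- have [p fp hp] := Vdef n k (map_tuple (tren r) ts).
  by exists p => // U A e he; rewrite hp // (tvals_ren _ _ _ (V U e)).
- exists (FSym C (map_tuple (tren r) ts)) => // U A e _ /=.
  by rewrite (tvals_ren _ _ _ (V U e)).
- have [p fp hp] := IH fo ef r; exists (FNot p) => // U A e he /=.
  by have := hp U A e he; tauto.
- case/andP: fo => fq fq'; case/andP: ef => eq eq'.
  have [p fp hp] := IHq fq eq r; have [p' fp' hp'] := IHq' fq' eq' r.
  exists (FAnd p p') => [|U A e he] /=; first by rewrite fp.
  by have := hp U A e he; have := hp' U A e he; tauto.
(* Being at least [M], [y] leaves [V] unchanged under the quantifier; being above all [r z], it
   captures no renamed free variable. *)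
- pose y := maxn M (\max_(z < bound q) (r z).+1).
  have hM : M <= y by rewrite leq_maxl.
  have hr z : z < bound q -> r z != y.
    move=> hz; rewrite neq_ltn; apply/orP; left; rewrite /y leq_max; apply/orP; right.
    exact: (leq_bigmax_cond (F := fun i : 'I_(bound q) => (r i).+1) (Ordinal hz)).
  have [p fp hp] := IH fo ef (fun z => if z == x then y else r z).
  exists (FEx y p) => // U A e he /=.
  have W a : dom A a -> sat A (upd e y a) p <->
      sat A (upd (Assignment (ival e \o r) (V U e)) x a) q.
    move=> ha; rewrite hp; last exact: upd_in.
    apply: sat_agree; split=> [z hz|n k _ _] /=; last by rewrite Vloc.
    by case: (z == x); rewrite ?eqxx // (negbTE (hr _ hz)).
  by split=> -[a ha h]; exists a => //; apply/W.
Qed.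

(** The values of [V] must be relations of the model here: only for those does equality amount to
    coextensionality over the domain. *)
Lemma first_order_subst M
    (V : forall U, assignment U -> forall n, nat -> set (n.+1.-tuple U))
    (Vloc : forall U e y a n k, M <= y -> V U (upd e y a) n k = V U e n k)
    (Vdef : forall n k (ts : n.+1.-tuple (term L)), exists2 p, first_order p &
       forall U (A : henkin L U) e, assignment_in A e ->
       sat A e p <-> V U e n k (map_tuple (tval A e) ts)) q :
  first_order q -> exists2 p, first_order p &
    forall U (A : henkin L U) e, assignment_in A e ->
    (forall n k, rels A n (V U e n k)) ->
    sat A e p <-> sat A (Assignment (ival e) (V U e)) q.
Proof.
move=> fo0; have fo : first_order (noeq q) by rewrite first_order_noeq.
have [p fp hp] := first_order_subst_eqfree Vloc Vdef fo (eqfree_noeq q) id.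
exists p => // U A e he hV; rewrite hp // sat_noeq //.
by case: he => he _; split.
Qed.

(** Needed for prenexing: a block whose names are all at least [N] can be moved over a formula whose
    variables lie below [N]. The shift [K] is also at least [bound q], so the new names do not occur
    in [q]. *)
Lemma rename_FExRs N Rs q : first_order q -> exists Rs' q',
  [/\ first_order q', (forall X, X \in Rs' -> N <= X.2) &
   forall U (A : henkin L U) e, assignment_in A e ->
   sat A e (FExRs Rs' q') <-> sat A e (FExRs Rs q)].
Proof.
move=> fo; pose K := maxn N (bound q).
pose s (n k : nat) : nat := if (n, k) \in Rs then k + K else k.
have [||p fp hp] := @first_order_subst 0 (fun U e n k => rval e n (s n k)) _ _ q fo.
- by [].
- by move=> n k ts; exists (FRel (s n k) ts).
pose Rs' := [seq (X.1, X.2 + K) | X <- Rs].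
have hRs' n k : (n, k) \in Rs' -> K <= k.
  by case/mapP => -[n' k'] _ [_ ->]; rewrite leq_addl.
have mRs' n k : (n, k) \in Rs -> (n, k + K) \in Rs'.
  by move=> h; apply/mapP; exists (n, k).
exists Rs', p; split=> // [[n k] /hRs' /= h|U A e he].
  by apply: leq_trans h; rewrite leq_maxl.
have W e' : assignment_in A e' -> sat A e' p <->
    sat A (Assignment (ival e') (fun n k => rval e' n (s n k))) q.
  by move=> he'; apply: hp => // n k; case: he'.
have small n k : k < bound q -> (n, k) \notin Rs'.
  move=> hk; apply/negP => /hRs'; apply/negP; rewrite -ltnNge (leq_trans hk) //.
  by rewrite leq_maxr.
rewrite !sat_FExRs //; split=> -[e' [he' [hi hv]]].
- move/W => /(_ he') h.
  exists (Assignment (ival e') (fun n k =>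
    if (n, k) \in Rs then rval e' n (k + K) else rval e n k)).
  split.
  + by case: he => _ h2; case: he' => h1 h3; split=> //= n k; case: ifP.
  + by split=> // n k /negbTE /= ->.
  + apply: (agree_sat _ h); split=> // n k _ hk /=; rewrite /s.
    by case: ifP => // _; rewrite hv // small.
- move=> h.
  pose e1 := Assignment (ival e') (fun n k =>
    if (n, k) \in Rs' then rval e' n (k - K) else rval e n k).
  have he1 : assignment_in A e1.
    by case: he => _ h2; case: he' => h1 h3; split=> //= n k; case: ifP.
  exists e1; split=> //; first by split=> // n k /negbTE /= ->.
  apply/W => //; apply: (agree_sat _ h); split=> // n k _ hk /=; rewrite /s.
  have [hn|hn] := boolP ((n, k) \in Rs); first by rewrite mRs' // addnK.
  by rewrite (negbTE (small _ _ hk)) hv.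
Qed.

End Substitution.

(** * Closure properties of the Sigma^1_1 formulas modulo T *)

(* Formulas up to equivalence: the predicates of a model and an assignment. *)
Definition mpred (L : signature) := forall U, henkin L U -> assignment U -> Prop.

Section Sigma.
Context (L : signature) (T : set (form L)).
Implicit Types (p q : form L) (P : mpred L).

Definition sigma P : Prop := exists2 p, Sigma11 p &
  forall U (A : henkin L U) e, model A T -> assignment_in A e ->
  sat A e p <-> P U A e.

Lemma sigma_ext P P' : sigma P ->
  (forall U (A : henkin L U) e, model A T -> assignment_in A e -> P U A e <-> P' U A e) ->
  sigma P'.
Proof. by move=> [p sp hp] h; exists p => // U A e mA he; rewrite hp // h. Qed.

Lemma sigma_sat p : Sigma11 p -> sigma (fun U A e => sat A e p).
Proof. by move=> sp; exists p. Qed.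

Lemma sigma_fo p : first_order p -> sigma (fun U A e => sat A e p).
Proof. by move=> sp; apply: sigma_sat; exists [::], p. Qed.

Lemma sigma_and P P' : sigma P -> sigma P' -> sigma (fun U A e => P U A e /\ P' U A e).
Proof.
move=> [_ [R1 [q1 [f1 ->]]] h1] [_ [R2 [q2 [f2 ->]]] h2].
(* The names in [R1'] are fresh for the second formula and those in [R2'] are fresh for [q1'], so
   the blocks can be concatenated without capture. *)
have [R1' [q1' [f1' b1 e1]]] := rename_FExRs (bound (FExRs R2 q2)) R1 f1.
have [R2' [q2' [f2' b2 e2]]] := rename_FExRs (bound q1') R2 f2.
exists (FExRs (R1' ++ R2') (FAnd q1' q2')).
  by exists (R1' ++ R2'), (FAnd q1' q2'); rewrite /= f1'.
move=> U A e mA he; rewrite -h1 // -h2 // -e1 // /FExRs foldr_cat -!/(FExRs _ _).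
rewrite !sat_FExRs //.
split=> [[e' [he' v' /(sat_FExRs _ _ he') [e'' [he'' v'' /= [s1 s2]]]]]|].
  split.
    exists e'; split=> //; apply: (agree_sat _ s1).
    exact: agree_sym (variant_agree b2 v'').
  apply/sat_FExRs/(sat_agree _ (variant_agree b1 v')) => //.
  by apply/e2 => //; apply/sat_FExRs => //; exists e''.
case=> -[e' [he' v' s1]] /(sat_FExRs _ _ he).
move/(sat_agree _ (variant_agree b1 v'))/(e2 _ _ _ he').
case/(sat_FExRs _ _ he') => e'' [he'' v'' s2].
exists e'; split=> //; apply/sat_FExRs => //; exists e''; split=> //; split=> //.
by apply: (agree_sat _ s1); exact: variant_agree b2 v''.
Qed.

Lemma sigma_or P P' : sigma P -> sigma P' -> sigma (fun U A e => P U A e \/ P' U A e).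
Proof.
move=> [_ [R1 [q1 [f1 ->]]] h1] [_ [R2 [q2 [f2 ->]]] h2].
have [R1' [q1' [f1' b1 e1]]] := rename_FExRs (bound (FExRs R2 q2)) R1 f1.
have [R2' [q2' [f2' b2 e2]]] := rename_FExRs (bound q1') R2 f2.
exists (FExRs (R1' ++ R2') (FOr q1' q2')).
  by exists (R1' ++ R2'), (FOr q1' q2'); rewrite /= f1'.
move=> U A e mA he; rewrite -h1 // -h2 // -e1 // /FExRs foldr_cat -!/(FExRs _ _).
rewrite !sat_FExRs //.
split=> [[e' [he' v' /(sat_FExRs _ _ he') [e'' [he'' v'' /sat_FOr [s1|s2]]]]]|].
- left; exists e'; split=> //; apply: (agree_sat _ s1).
  exact: agree_sym (variant_agree b2 v'').
- right; apply/sat_FExRs/(sat_agree _ (variant_agree b1 v')) => //.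
  by apply/e2 => //; apply/sat_FExRs => //; exists e''.
- case=> [[e' [he' v' s1]]|
    /(sat_FExRs _ _ he)/(e2 _ _ _ he)/(sat_FExRs _ _ he) [e' [he' v' s2]]].
    exists e'; split=> //; apply/sat_FExRs => //; exists e'; split=> //.
    by apply/sat_FOr; left.
  exists e; split=> //; apply/sat_FExRs => //; exists e'; split=> //.
  by apply/sat_FOr; right.
Qed.

Lemma upd_variant U (e e' : assignment U) x a Rs :
  variant Rs e e' -> variant Rs (upd e x a) (upd e' x a).
Proof. by case=> h1 h2; split=> //=; rewrite h1. Qed.

Lemma sigma_ex P x :
  sigma P -> sigma (fun U A e => exists2 a, dom A a & P U A (upd e x a)).
Proof.
move=> [_ [R1 [q1 [f1 ->]]] h1]; exists (FExRs R1 (FEx x q1)).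
  by exists R1, (FEx x q1).
move=> U A e mA he; rewrite sat_FExRs //; split=> [[e' [he' v' [a ha s]]]|].
  exists a => //; apply/h1 => //; first exact: upd_in.
  apply/sat_FExRs; first exact: upd_in.
  by exists (upd e' x a); split=> //; [exact: upd_in|exact: upd_variant].
case=> a ha; have hea := upd_in x he ha; move/h1 => /(_ mA hea)/(sat_FExRs _ _ hea).
case=> e' [he' v' s]; exists (upd e' x (ival e x)); split.
- by apply: upd_in => //; case: he.
- by rewrite -[e in variant _ e](upd_id e x); have := upd_variant x (ival e x) v';
    rewrite (_ : upd (upd e x a) x (ival e x) = upd e x (ival e x)) //;
    apply: assignment_eq => //=; apply: funext => y; case: eqP.
- exists a => //.
  rewrite (_ : upd _ _ _ = e') //; apply: assignment_eq => //=.
  by case: v' => /= <- _; apply: funext => y; case: eqP.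
Qed.

Lemma sigma_exR P n k :
  sigma P -> sigma (fun U A e => exists2 R, rels A n R & P U A (updR e k R)).
Proof.
move=> [_ [R1 [q1 [f1 ->]]] h1]; exists (FExRs ((n, k) :: R1) q1).
  by exists ((n, k) :: R1), q1.
move=> U A e mA he /=; split=> -[R hR s]; exists R => //; apply/h1 => //.
  exact: updR_in.
exact: updR_in.
Qed.

End Sigma.

(** * Comprehension and choice for sections of relations *)

Section Choice.
Context (L : signature) (T : set (form L)).
Hypothesis hAC : extends_Sigma11_AC0 T.
Implicit Types (p q : form L) (P : mpred L).

Definition section U n (R : set (n.+2.-tuple U)) (a : U) : set (n.+1.-tuple U) :=
  [set t | R (cons_tuple a t)].

Lemma map_cat1 (U : Type) (f : nat -> U) n x (t : n.-tuple nat) :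
  map_tuple f (cat_tuple (in_tuple [:: x]) t) = cons_tuple (f x) (map_tuple f t).
Proof. exact: val_inj. Qed.

Lemma uniq_cons_iota x n : uniq (x :: iota_tuple n x.+1).
Proof. by rewrite /= iota_uniq mem_iota ltnn. Qed.

(** This is comprehension for the atomic formula stating that $x_0, x_1, \ldots, x_{n+1}$ are
    related by [R], with $x_0$ as a parameter whose value is [a]. *)
Lemma rels_section U (A : henkin L U) n R a :
  model A T -> rels A n.+1 R -> dom A a -> rels A n (section R a).
Proof.
move=> mA hR ha.
have [i0 hi0] := dom_neq0 A.
pose e0 : assignment U := Assignment (fun _ => i0) (fun n _ => xget set0 (rels A n)).
have he0 : assignment_in A e0.
  by split=> // m k; exact: (@xgetPex _ set0 _ (rels_neq0 A m)).
pose e := updR (upd e0 0 a) 1 R.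
have he : assignment_in A e by apply: updR_in => //; exact: upd_in.
have nf : ~~ freeR (n, 0) (@FRelv L n.+1 1 (cons_tuple 0 (iota_tuple n.+1 1))).
  by rewrite /= xpair_eqE andbF.
have /hAC/(_ _ _ mA _ he)/sat_FExR[S hS] :=
  @ax_comp L n 0 (iota_tuple n.+1 1) (@FRelv L n.+1 1 (cons_tuple 0 (iota_tuple n.+1 1)))
    (iota_uniq 1 n.+1) isT nf.
rewrite (@sat_FAlls_tuple _ _ _ _ _ _ _ (fun t => S t <-> R (cons_tuple a t)) (iota_uniq _ _)).
  move=> hSR; suff <- : S = section R a by [].
  apply/seteqP; split=> t ht; first by apply/hSR => //; exact: rels_sub ht.
  apply/hSR => // i; have := rels_sub hR ht (lift ord0 i).
  by rewrite !(tnth_nth a).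
move=> f hf; rewrite sat_FIff.
rewrite !sat_FRelv updR_same updR_other ?updR_same; last by rewrite xpair_eqE andbF.
suff -> : map_tuple f (cons_tuple 0 (iota_tuple n.+1 1)) =
    cons_tuple a (map_tuple f (iota_tuple n.+1 1)).
  exact: iff_refl.
apply: val_inj; rewrite /= hf ?mem_iota //.
Qed.

(** The instance of the schema with the single variable [x] in front. The relation that the axiom
    introduces as $R'[x]$ is the actual section: both are relations of the model and they agree over
    the domain. *)
Lemma choice_sat U (A : henkin L U) e n k k' x phi :
  model A T -> assignment_in A e -> Sigma11 phi ->
  ~~ freeR (n.+1, k') phi ->
  (forall a, dom A a -> exists2 R, rels A n R & sat A (updR (upd e x a) k R) phi) ->
  exists2 R', rels A n.+1 R' & forall a, dom A a ->
    sat A (updR (upd (updR e k' R') x a) k (section R' a)) phi.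
Proof.
move=> mA he sphi fphi h.
have ux : uniq (in_tuple [:: x] ++ iota_tuple n.+1 x.+1) by exact: uniq_cons_iota.
have /hAC/(_ _ _ mA _ he)/sat_FImp hch := @ax_choice L 0 n k k' (in_tuple [:: x])
  (iota_tuple n.+1 x.+1) phi ux sphi fphi.
have hall : sat A e (FAlls (in_tuple [:: x]) (FExR n k phi)).
  by apply/sat_FAll => a ha; exact: h.
have /sat_FExR[R' hR' hs] := hch hall.
exists R' => // a ha; move/sat_FAll: hs => /(_ a ha)/sat_FExR[R hR /sat_FAnd[hRR' hs]].
rewrite (_ : section R' a = R) //; apply: (power_ext (A := A)) => //.
  exact: rels_section.
move: hRR'.
rewrite (@sat_FAlls_tuple _ _ _ _ _ _ _ (fun t => R t <-> R' (cons_tuple a t))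
  (iota_uniq _ _)).
  by move=> hRR' t /hRR' [h1 h2]; split.
move=> f hf; rewrite sat_FIff !sat_FRelv map_cat1 updR_same.
rewrite updR_other ?updR_same; last by rewrite xpair_eqE gtn_eqF.
by rewrite hf ?mem_iota ?ltnn //= eqxx.
Qed.

End Choice.

(** * Closure under universal individual quantifiers *)

Section Universal.
Context (L : signature) (T : set (form L)).
Hypothesis hAC : extends_Sigma11_AC0 T.
Implicit Types (p q : form L) (P : mpred L).

(** An atom with the variable [k] becomes an atom with [k'] and the additional first argument [x];
    the threshold [x.+1] keeps bound variables away from [x]. *)
Lemma section_subst n k k' x q : first_order q -> exists2 p, first_order p &
  forall U (A : henkin L U) e, assignment_in A e ->
  rels A n (section (rval e n.+1 k') (ival e x)) ->
  sat A e p <-> sat A (updR e k (section (rval e n.+1 k') (ival e x))) q.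
Proof.
move=> fq.
have [||p fp hp] := @first_order_subst L x.+1 (fun U e =>
  rval (updR e k (section (rval e n.+1 k') (ival e x)))) _ _ q fq.
- move=> U e y a n1 k1 xy.
  have -> : ival (upd e y a) x = ival e x by rewrite /= ltn_eqF.
  by [].
- move=> n1 k1 ts; have [E|ne] := eqVneq (n1, k1) (n, k); last first.
    by exists (FRel k1 ts) => // U A e _; rewrite updR_other.
  case: E ts => -> -> ts; exists (@FRel L n.+1 k' (cons_tuple (TVar x) ts)) => // U A e _.
  rewrite updR_same /= (_ : map_tuple _ (cons_tuple _ _) =
    cons_tuple (ival e x) (map_tuple (tval A e) ts)) //.
  exact: val_inj.
exists p => // U A e he hs; apply: hp => // n1 k1.
by case: (updR_in k he hs).
Qed.

(** The block quantifies neither the sectioned relation nor the variable that the section replaces,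
    so the section is the same outside and inside the block. *)
Lemma section_FExRs n k k' x Rs q : first_order q ->
  (n, k) \notin Rs -> (n.+1, k') \notin Rs -> exists2 p, first_order p &
  forall U (A : henkin L U) e, assignment_in A e ->
  rels A n (section (rval e n.+1 k') (ival e x)) ->
  sat A e (FExRs Rs p) <->
  sat A (updR e k (section (rval e n.+1 k') (ival e x))) (FExRs Rs q).
Proof.
move=> fq nk nk'; have [p fp hp] := section_subst n k k' x fq.
exists p => // U A e he hs; rewrite !sat_FExRs //; last exact: updR_in.
split=> -[e' [he' [hi hv] h]].
- have E : section (rval e n.+1 k') (ival e x) = section (rval e' n.+1 k') (ival e' x).
    by rewrite hi hv.
  exists (updR e' k (section (rval e' n.+1 k') (ival e' x))); split.
  + by apply: updR_in => //; rewrite -E.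
  + split=> // n1 k1 h1; rewrite E; have [[-> ->]|ne] := eqVneq (n1, k1) (n, k).
      by rewrite !updR_same.
    by rewrite !updR_other // hv.
  + by apply/hp => //; rewrite -E.
(* The variable [k] gets back its value under [e], because the new assignment may differ from [e] on
   [Rs] only. *)
- pose e1 := updR e' k (rval e n k).
  have ne : (n.+1, k') != (n, k) by rewrite xpair_eqE gtn_eqF.
  have Es : section (rval e1 n.+1 k') (ival e1 x) = section (rval e n.+1 k') (ival e x).
    by rewrite /e1 updR_other // -hv // updR_other // [ival _]/= -hi.
  have he1 : assignment_in A e1 by apply: updR_in => //; case: he.
  exists e1; split=> //.
    split=> // n1 k1 h1; have [[-> ->]|ne1] := eqVneq (n1, k1) (n, k).
      by rewrite updR_same.
    by rewrite updR_other // -hv // updR_other.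
  apply/hp => //; rewrite Es //.
  rewrite (_ : updR e1 _ _ = e') //; apply: assignment_eq => // n1 k1.
  have [[-> ->]|ne1] := eqVneq (n1, k1) (n, k).
    by rewrite updR_same -hv // updR_same.
  by rewrite !updR_other.
Qed.

Lemma FExRs_dup n k Rs q U (A : henkin L U) e : assignment_in A e ->
  (n, k) \in Rs -> sat A e (FExRs ((n, k) :: Rs) q) <-> sat A e (FExRs Rs q).
Proof.
move=> he h; rewrite !sat_FExRs //.
by split=> -[e' [he' [h1 h2] s]]; exists e'; split=> //; split=> // n1 k1 hn; apply: h2;
  move: hn; rewrite ?inE ?negb_or; [case: eqP => // -[-> ->]; rewrite h|case/andP].
Qed.

(* The axiom of choice turns the outermost relation quantifier after
   [forall x] into one before it, whose variable is then sectioned at x. *)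
Lemma sigma_all_FExRs m x Rs q : size Rs <= m -> first_order q ->
  sigma T (fun U A e => forall a, dom A a -> sat A (upd e x a) (FExRs Rs q)).
Proof.
elim: m Rs q => [|m IH] [|[n k] Rs] q // sz fq;
  try by apply: (sigma_ext (sigma_fo T (fq : first_order (FAll x q)))) => U A e _ _;
         exact: sat_FAll.
(* If the variable is quantified again inside, the outer quantifier is vacuous and is dropped;
   otherwise the sectioning applies. *)
have [hin|hin] := boolP ((n, k) \in Rs).
  apply: (sigma_ext (IH _ _ (sz : size Rs <= m) fq)) => U A e _ he.
  by split=> h a ha; have := h a ha; rewrite FExRs_dup //; exact: upd_in.
(* [k'] lies above all variables of the formula, the bound ones included: the choice schema and the
   sectioning both ask for this. *)
pose phi := FExRs Rs q; pose k' := bound (FExR n k phi).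
have k'Rs : (n.+1, k') \notin Rs.
  apply/negP => /FExRs_bound - /(_ _ q) /=; rewrite ltnNge /k' /= !leq_max leqnn.
  by rewrite orbT.
have k'phi : ~~ freeR (n.+1, k') phi.
  apply/negP => /freeR_bound /andP[_]; rewrite ltnNge /k' /= !leq_max leqnn.
  by rewrite orbT.
have [p fp hp] := section_FExRs x fq hin k'Rs.
apply: (sigma_ext (sigma_exR n.+1 k' (IH Rs p (sz : size Rs <= m) fp))) => U A e mA he.
split=> [[R' hR' h] a ha|h].
  pose e1 := upd (updR e k' R') x a.
  have he1 : assignment_in A e1 by apply: upd_in => //; exact: updR_in.
  have E1 : section (rval e1 n.+1 k') (ival e1 x) = section R' a.
    by rewrite /e1 /= eqxx dfwith_in eqxx.
  have hs : rels A n (section R' a) by exact: (rels_section hAC mA hR' ha).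
  have := h a ha; rewrite (hp _ _ e1 he1) E1 // => s.
  exists (section R' a) => //; apply: agree_sat s; split=> // n1 k1 _ hk1.
  have [[-> ->]|ne1] := eqVneq (n1, k1) (n, k); first by rewrite !updR_same.
  rewrite !updR_other //.
  rewrite xpair_eqE negb_and orbC ltn_eqF // (leq_trans hk1) //.
  by rewrite /k' /= !leq_max leqnn orbT.
have sphi : Sigma11 phi by exists Rs, q.
have [R' hR' hs] := choice_sat hAC mA he sphi k'phi h.
exists R' => // a ha.
pose e1 := upd (updR e k' R') x a.
have he1 : assignment_in A e1 by apply: upd_in => //; exact: updR_in.
have E1 : section (rval e1 n.+1 k') (ival e1 x) = section R' a.
  by rewrite /e1 /= eqxx dfwith_in eqxx.
rewrite (hp _ _ e1 he1) E1; first exact: hs.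
exact: (rels_section hAC mA hR' ha).
Qed.

Lemma sigma_all P x :
  sigma T P -> sigma T (fun U A e => forall a, dom A a -> P U A (upd e x a)).
Proof.
move=> [_ [Rs [q [fq ->]]] hP].
apply: (sigma_ext (sigma_all_FExRs x (leqnn (size Rs)) fq)) => U A e mA he.
by split=> h a ha; apply/hP => //; try exact: upd_in; exact: h.
Qed.

End Universal.

(** * Formulas with prescribed free variables *)

Section ExactVariables.
Context (L : signature) (T : set (form L)).
Implicit Types (p q : form L).

Definition FExs (xs : seq nat) p : form L := foldr (@FEx L) p xs.

Lemma free_FExs x xs p : free x (FExs xs p) = (x \notin xs) && free x p.
Proof.
elim: xs => //= y xs ->; rewrite inE negb_or eq_sym.
by case: (x == y).
Qed.

Lemma freeR_FExs X xs p : freeR X (FExs xs p) = freeR X p.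
Proof. by elim: xs. Qed.

Lemma free_FExRs x Rs p : free x (FExRs Rs p) = free x p.
Proof. by elim: Rs. Qed.

Lemma freeR_FExRs X Rs p : freeR X (FExRs Rs p) = (X \notin Rs) && freeR X p.
Proof.
elim: Rs => //= -[n k] Rs -> /=; rewrite inE negb_or eq_sym.
by case: (X == _).
Qed.

Lemma first_order_FExs xs p : first_order (FExs xs p) = first_order p.
Proof. by elim: xs. Qed.

Lemma sat_FExs U (A : henkin L U) e xs p : assignment_in A e ->
  sat A e (FExs xs p) <-> exists e', [/\ assignment_in A e',
    (forall n k, rval e n k = rval e' n k),
    (forall x, x \notin xs -> ival e x = ival e' x) & sat A e' p].
Proof.
elim: xs e => [|x xs IH] e he /=.
  split=> [h|[e' [_ h1 h2 h]]]; first by exists e.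
  by rewrite (_ : e = e') //; apply: assignment_eq => //; apply: funext => x; exact: h2.
split=> [[a ha /(IH _ (upd_in x he ha)) [e' [he' h1 h2 h]]]|[e' [he' h1 h2 h]]].
  exists e'; split=> // y; rewrite inE negb_or => /andP[ne hn].
  by rewrite -h2 //= (negbTE ne).
exists (ival e' x); first by case: he'.
apply/IH; first by apply: upd_in => //; case: he'.
exists e'; split=> // y hn /=.
by have [->//|ne] := eqVneq y x; rewrite h2 // inE negb_or ne.
Qed.

(* Adds the variables of Rs to the free variables of p. *)
Definition mention (Rs : seq (nat * nat)) p : form L :=
  foldr (fun X r => FAnd (FREq X.1 X.2 X.2) r) p Rs.

Lemma sat_mention U (A : henkin L U) e Rs p : sat A e (mention Rs p) <-> sat A e p.
Proof. by elim: Rs => //= X Rs ->; split=> [[]|]. Qed.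

Lemma freeR_mention X Rs p : freeR X (mention Rs p) = (X \in Rs) || freeR X p.
Proof.
by elim: Rs => //= -[n k] Rs ->; rewrite inE orbb orbA eq_sym.
Qed.

Lemma free_mention x Rs p : free x (mention Rs p) = free x p.
Proof. by elim: Rs. Qed.

Lemma first_order_mention Rs p : first_order (mention Rs p) = first_order p.
Proof. by elim: Rs. Qed.

Lemma exact_variables Rs Q p : generalized_quantifier Rs Q -> Sigma11 p ->
  (forall U (A : henkin L U) e, model A T -> assignment_in A e ->
     sat A e p <-> sat A e Q) ->
  exists Rs' q, [/\ first_order q, (forall x, ~~ free x (FExRs Rs' q)),
    (forall X, freeR X (FExRs Rs' q) = (X \in Rs)) &
    forall U (A : henkin L U) e, model A T -> assignment_in A e ->
     sat A e (FExRs Rs' q) <-> sat A e Q].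
Proof.
move=> [uRs fQ fRQ] [R1 [q1 [f1 ->]]] hp.
(* The bound names are moved above those of [Rs], so that a variable of [Rs] mentioned in the matrix
   is free in the whole formula. *)
have [R2 [q2 [f2 b2 h2]]] := rename_FExRs (\max_(X <- Rs) X.2.+1) R1 f1.
pose M := bound q2.
(* [Y] contains every relation variable outside [Rs] that can be free in [q2]. *)
pose Y := [seq X <- [seq (n, k) | n <- iota 0 M, k <- iota 0 M] | X \notin Rs].
have hY X : X \in Rs -> X \notin Y ++ R2.
  move=> hX; rewrite mem_cat mem_filter hX /=; apply/negP => /b2.
  rewrite leqNgt => /negP; apply.
  rewrite -(big_map (fun X : nat * nat => X.2.+1) predT id).
  exact: leq_bigmax_seq (map_f _ hX) isT.
have hM X : X \notin Rs -> freeR X q2 -> X \in Y ++ R2.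
  case: X => n k nX /freeR_bound/andP[hn hk]; rewrite mem_cat mem_filter nX /=.
  by rewrite allpairs_f // mem_iota.
pose q := FExs (iota 0 M) (mention Rs q2).
have hQ U (A : henkin L U) e e' : variant (Y ++ R2) e e' -> sat A e Q <-> sat A e' Q.
  move=> [v1 v2]; split; apply: sat_coincide => [x hx|n k hk];
    by [have := fQ x; rewrite hx|rewrite v2 // hY // fRQ].
exists (Y ++ R2), q; split.
- by rewrite first_order_FExs first_order_mention.
- move=> x; rewrite free_FExRs free_FExs free_mention mem_iota /= add0n.
  by apply/negP => /andP[/negP hx /free_bound].
- move=> X; rewrite freeR_FExRs freeR_FExs freeR_mention.
  have [hX|hX] := boolP (X \in Rs); first by rewrite hY.
  by apply/negP => /andP[/negP h /(hM _ hX)].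
- move=> U A e mA he; rewrite sat_FExRs //; split.
    case=> e1 [he1 v1 /(sat_FExs _ _ he1) [e2 [he2 h3 h4 /sat_mention s]]].
    apply/(hQ _ _ _ _ v1).
    have : sat A e2 Q.
      by apply/hp => //; apply/h2 => //; apply/sat_FExRs => //; exists e2.
    by apply: sat_coincide => // x hx; have := fQ x; rewrite hx.
  move=> /(hp _ _ _ mA he)/(h2 _ _ _ he)/(sat_FExRs _ _ he) [e1 [he1 [v1 v2] s]].
  exists e1; split=> //.
    by split=> // n k; rewrite mem_cat negb_or => /andP[_]; exact: v2.
  by apply/sat_FExs => //; exists e1; split=> //; apply/sat_mention.
Qed.

Lemma sat_FAllRs_intro U (A : henkin L U) e Rs p : valid A p -> assignment_in A e ->
  sat A e (FAllRs Rs p).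
Proof.
move=> h; elim: Rs e => [|X Rs IH] e he /=; first exact: h.
by case=> R hR; apply; apply: IH; exact: updR_in.
Qed.

Lemma sat_FAllRs_not U (A : henkin L U) e Rs p :
  sat A e (FAllRs Rs (FNot p)) <-> ~ sat A e (FExRs Rs p).
Proof.
elim: Rs e => //= X Rs IH e; split=> h [R hR s]; apply: h; exists R => //.
  by move/IH.
by apply: contrapT => /IH.
Qed.

Lemma free_FAllRs x Rs p : free x (FAllRs Rs p) = free x p.
Proof. by elim: Rs. Qed.

Lemma freeR_FAllRs X Rs p : freeR X (FAllRs Rs p) = freeR X (FExRs Rs p).
Proof. by elim: Rs => //= -[n k] Rs ->. Qed.

Lemma sigma_definable Rs Q : generalized_quantifier Rs Q ->
  sigma T (fun U A e => sat A e Q) -> Sigma11_definable T Rs Q.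
Proof.
move=> gQ [p sp hp]; have [Rs' [q [fq h1 h2 h3]]] := exact_variables gQ sp hp.
exists (FExRs Rs' q); split=> //; first by exists Rs', q.
move=> U A mA e he; apply: sat_FAllRs_intro => // e' he'.
by apply/sat_FIff; rewrite h3.
Qed.

Lemma pi_definable Rs Q : generalized_quantifier Rs Q ->
  sigma T (fun U A e => sat A e (FNot Q)) -> Pi11_definable T Rs Q.
Proof.
move=> gQ [p sp hp].
have gQ' : generalized_quantifier Rs (FNot Q) by [].
have [Rs' [q [fq h1 h2 h3]]] := exact_variables gQ' sp hp.
exists (FAllRs Rs' (FNot q)); split.
- by exists Rs', (FNot q).
- by move=> x; rewrite free_FAllRs /= -(free_FExRs _ Rs').
- by move=> X; rewrite freeR_FAllRs -h2 !freeR_FExRs.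
move=> U A mA e he; apply: sat_FAllRs_intro => // e' he'.
apply/sat_FIff; rewrite sat_FAllRs_not h3 //=.
by split=> [s|/contrapT].
Qed.

End ExactVariables.

(** * Models from truth definitions *)

(* NI is a set of names of individuals, and r picks a representative of each
   class of names of the same individual. *)
Section TruthModel.
Context (L : signature) (NI : Type) (r : NI -> NI) (i0 : NI).
Context (cst : const L -> NI) (sy : forall n, rsym L n -> set (n.+1.-tuple NI)).
Hypothesis rK : forall i, r (r i) = r i.
Hypothesis sy_r : forall n (C : rsym L n) t, sy C (map_tuple r t) <-> sy C t.
Implicit Types (p q : form L).

Definition reps : set NI := [set i | r i = i].

Lemma power_reps n (t : n.-tuple NI) : power reps n (map_tuple r t).
Proof. by move=> i; rewrite tnth_map /reps /= rK. Qed.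

Definition nval (f : nat -> NI) (t : term L) : NI :=
  match t with TVar x => f x | TCst c => cst c end.

Definition nupd (f : nat -> NI) (x : nat) (i : NI) : nat -> NI :=
  fun y => if y == x then i else f y.

Section Side.
Context (NR : nat -> Type) (K0 : forall n, NR n).
Context (app : forall n, NR n -> set (n.+1.-tuple NI)).
Hypothesis app_r : forall n (K : NR n) t, app K (map_tuple r t) <-> app K t.
Implicit Types (g : forall n, nat -> NR n) (f : nat -> NI).

Definition nupdR g n (k : nat) (K : NR n) : forall n, nat -> NR n :=
  dfwith g (fun j => if j == k then K else g n j).

Definition ext n (K : NR n) : set (n.+1.-tuple NI) :=
  [set t | power reps n.+1 t /\ app K t].

Definition truth_rels n : set (set (n.+1.-tuple NI)) := [set R | exists K, R = ext K].

Lemma truth_dom_neq0 : reps !=set0.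
Proof. by exists (r i0); rewrite /reps /= rK. Qed.

Lemma truth_rels_neq0 n : @truth_rels n !=set0.
Proof. by exists (ext (K0 n)), (K0 n). Qed.

Lemma truth_rels_sub n R : @truth_rels n R -> R `<=` power reps n.+1.
Proof. by case=> K -> t []. Qed.

Lemma truth_cst_dom (c : const L) : reps (r (cst c)).
Proof. exact: rK. Qed.

Definition truth_sym n (C : rsym L n) : set (n.+1.-tuple NI) :=
  [set t | power reps n.+1 t /\ sy C t].

Lemma truth_sym_sub n (C : rsym L n) : truth_sym C `<=` power reps n.+1.
Proof. by move=> t []. Qed.

Definition truth_model : henkin L NI :=
  Henkin truth_dom_neq0 truth_rels_neq0 truth_rels_sub truth_cst_dom truth_sym_sub.

Definition asg f g : assignment NI := Assignment (r \o f) (fun n k => ext (g n k)).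

Lemma asg_in f g : assignment_in truth_model (asg f g).
Proof. by split=> [x|n k]; [exact: rK|exists (g n k)]. Qed.

Lemma asg_surj e : assignment_in truth_model e -> exists f g, e = asg f g.
Proof.
case=> h1 h2; exists (ival e), (fun n k => projT1 (cid (h2 n k))).
apply: assignment_eq => /= [|n k]; last by case: cid.
by apply: funext => x; rewrite -[LHS](h1 x).
Qed.

Lemma asg_upd f g x i : asg (nupd f x i) g = upd (asg f g) x (r i).
Proof.
by apply: assignment_eq => //; apply: funext => y /=; rewrite /nupd; case: eqP.
Qed.

Lemma asg_updR f g n k K : asg f (nupdR g (n := n) k K) = updR (asg f g) k (ext K).
Proof.
apply: assignment_eq => // n' k' /=; rewrite /nupdR.
by case: dfwithP => [|j ne]; rewrite ?dfwith_in ?dfwith_out //; case: eqP.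
Qed.

(** The clauses concern formulas in [F] only, since the generic construction decides no more than
    countably many formulas. Relation equality is kept out of [F]: distinct names may have the same
    extension. *)
Definition tarski (F : form L -> Prop)
    (tr : form L -> (nat -> NI) -> (forall n, nat -> NR n) -> Prop) : Prop :=
  forall p, F p -> forall f g, match p with
  | FEq s t => tr p f g <-> r (nval f s) = r (nval f t)
  | FREq _ _ _ => False
  | FRel n k ts => tr p f g <-> app (g n k) (map_tuple (nval f) ts)
  | FSym n C ts => tr p f g <-> sy C (map_tuple (nval f) ts)
  | FNot q => F q /\ (tr p f g <-> ~ tr q f g)
  | FAnd q q' => [/\ F q, F q' & tr p f g <-> tr q f g /\ tr q' f g]
  | FEx x q => F q /\ (tr p f g <-> exists i, tr q (nupd f x i) g)
  | FExR n k q => F q /\ (tr p f g <-> exists K, tr q f (nupdR g (n := n) k K))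
  end.

Lemma tval_asg f g t : tval truth_model (asg f g) t = r (nval f t).
Proof. by case: t. Qed.

Lemma tvals_asg f g n (ts : n.-tuple (term L)) :
  map_tuple (tval truth_model (asg f g)) ts = map_tuple r (map_tuple (nval f) ts).
Proof. by apply: eq_from_tnth => i; rewrite !tnth_map tval_asg. Qed.

Lemma truth_lemma F tr : tarski F tr -> forall p f g, F p ->
  sat truth_model (asg f g) p <-> tr p f g.
Proof.
move=> hF; elim=> [s t|n k l|n k ts|n C ts|q IH|q IHq q' IHq'|x q IH|n k q IH] f g hp;
  have /= := hF _ hp f g.
- by rewrite !tval_asg => ->.
- by [].
- move=> ->; rewrite tvals_asg /ext /= app_r.
  by split=> [[]|h] //; split=> //; exact: power_reps.
- move=> ->; rewrite tvals_asg /truth_sym /= sy_r.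
  by split=> [[]|h] //; split=> //; exact: power_reps.
- by move=> [hq ->]; have := IH f g hq; tauto.
- by move=> [hq hq' ->]; have := IHq f g hq; have := IHq' f g hq'; tauto.
- move=> [hq ->]; split=> [[i ri s]|[i s]].
    by exists i; apply/IH => //; rewrite asg_upd ri.
  by exists (r i); [exact: rK|rewrite -asg_upd; apply/IH].
- move=> [hq ->]; split=> [[R [K ->] s]|[K s]].
    by exists K; apply/IH => //; rewrite asg_updR.
  by exists (ext K); [exists K|rewrite -asg_updR; apply/IH].
Qed.

Lemma truth_valid F tr p : tarski F tr -> F p -> (forall f g, tr p f g) ->
  valid truth_model p.
Proof. by move=> hF hp h e /asg_surj[f [g ->]]; apply/(truth_lemma hF). Qed.

End Side.

(** Individuals, constants and symbols are common to both sides, so only the names of relations have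
    to be matched. *)
Lemma truth_substructure (NRA NRB : nat -> Type) KA KB
    (appA : forall n, NRA n -> set (n.+1.-tuple NI))
    (appB : forall n, NRB n -> set (n.+1.-tuple NI)) :
  (forall n (K : NRA n), exists K' : NRB n, appA n K = appB n K') ->
  substructure (truth_model KA appA) (truth_model KB appB).
Proof.
move=> h; split=> //= [n R [K ->]|n C].
  by have [K' hK] := h n K; exists K'; rewrite /ext hK.
by apply/seteqP; split=> t [] // [].
Qed.

End TruthModel.

(** * Pairs of models that are inseparable by Sigma^1_1 formulas *)

Section Closures.
Context (L : signature) (T : set (form L)).
Implicit Types (p q : form L) (P : mpred L) (f : nat -> nat) (g : nat -> nat -> nat).

Definition ren f g U (e : assignment U) : assignment U :=
  Assignment (ival e \o f) (fun n k => rval e n (g n k)).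

Definition dbl U (e : assignment U) : assignment U := ren id (fun _ k => k.*2) e.

Lemma ren_in f g U (A : henkin L U) e : assignment_in A e -> assignment_in A (ren f g e).
Proof. by case=> h1 h2; split=> *; [exact: h1|exact: h2]. Qed.

(** Numbers serve both as variables and as Henkin constants. This is the instance of [p] at the
    constants [f x] and [g n k], read as a condition on the values that an assignment gives to the
    constants. *)
Definition clo p f g : mpred L := fun U A e => sat A (ren f g e) p.

Definition pnot P : mpred L := fun U A e => ~ P U A e.
Definition pand P P' : mpred L := fun U A e => P U A e /\ P' U A e.
Definition pdbl P : mpred L := fun U A e => P U A (dbl e).

Definition entails (a P : mpred L) : Prop := forall U (A : henkin L U) e,
  model A T -> assignment_in A e -> a U A e -> P U A e.

(** Finite support replaces the condition that only finitely many Henkin constants are mentioned: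
    all names from [N] on are fresh. *)
Definition supp N (a : mpred L) : Prop := forall U (A : henkin L U) e e',
  agree N e e' -> a U A e -> a U A e'.

Lemma supp_leq M N a : M <= N -> supp M a -> supp N a.
Proof. by move=> le h U A e e' /(agree_leq le); exact: h. Qed.

Lemma supp_pand M N a b : supp M a -> supp N b -> supp (maxn M N) (pand a b).
Proof.
move=> ha hb U A e e' he [h1 h2]; split.
  by apply: ha h1; apply: agree_leq he; rewrite leq_maxl.
by apply: hb h2; apply: agree_leq he; rewrite leq_maxr.
Qed.

Lemma supp_pnot N a : supp N a -> supp N (pnot a).
Proof. by move=> h U A e e' he; apply: contra_not; apply: h; exact: agree_sym. Qed.

Lemma agree_dbl N U (e e' : assignment U) : agree N.*2 e e' -> agree N (dbl e) (dbl e').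
Proof.
move=> [h1 h2]; split=> [x hx|n k hn hk] /=.
  by rewrite h1 // (leq_trans hx) // -addnn leq_addr.
by rewrite h2 ?ltn_double // (leq_trans hn) // -addnn leq_addr.
Qed.

Lemma supp_pdbl N a : supp N a -> supp N.*2 (pdbl a).
Proof. by move=> h U A e e' /agree_dbl; exact: h. Qed.

Lemma below_bounded (h : nat -> nat) m : exists N, forall x, x < m -> h x < N.
Proof.
exists (\max_(x < m) (h x).+1) => x hx.
exact: (leq_bigmax_cond (F := fun i : 'I_m => (h i).+1) (Ordinal hx)).
Qed.

Lemma below_bounded2 (h : nat -> nat -> nat) m :
  exists N, forall n k, n < m -> k < m -> h n k < N.
Proof.
have /choice[b hb] n := below_bounded (h n) m.
have [N hN] := below_bounded b m.
by exists N => n k hn hk; exact: ltn_trans (hb n k hk) (hN n hn).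
Qed.

Lemma supp_clo p f g : exists N, supp N (clo p f g).
Proof.
pose m := bound p; have [N1 hN1] := below_bounded f m.
have [N2 hN2] := below_bounded2 g m.
exists (maxn m (maxn N1 N2)) => U A e e' [h1 h2].
apply: agree_sat; split=> [x hx|n k hn hk] /=.
  by apply: h1; rewrite !leq_max hN1 ?orbT.
apply: h2; first by rewrite leq_max hn.
by rewrite !leq_max hN2 ?orbT.
Qed.

(* a and b are predicates of assignments in two models A and B that are to
   have the same domain, with S_n[A] included in S_n[B]; the relation variable
   k of A is the variable 2k of B, and B has the odd ones in addition. *)
Definition insep (a b : mpred L) : Prop :=
  forall S, sigma T S -> entails a S -> ~ entails b (pnot (pdbl S)).

Lemma sigma_false : sigma T (fun U A e => False).
Proof.
apply: (sigma_ext (sigma_fo T (isT : first_order (FNot (FEq (TVar 0) (TVar 0)) : form L)))).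
by move=> U A e _ _ /=; split.
Qed.

Lemma sigma_true : sigma T (fun U A e => True).
Proof.
apply: (sigma_ext (sigma_fo T (isT : first_order (FEq (TVar 0) (TVar 0) : form L)))).
by move=> U A e _ _ /=; split.
Qed.

Lemma insep_consL a b : insep a b -> ~ entails a (fun U A e => False).
Proof. by move=> h1 h2; apply: (h1 _ sigma_false h2) => U A e _ _ _ []. Qed.

Lemma insep_consR a b : insep a b -> ~ entails b (fun U A e => False).
Proof. by move=> h1 h2; apply: (h1 _ sigma_true) => // U A e h3 h4 /h2 []. Qed.

(** If both extensions could be separated from [b], the disjunction of the separating formulas would
    separate [a] from [b]. *)
Lemma insep_decL a b P : insep a b -> insep (pand a P) b \/ insep (pand a (pnot P)) b.
Proof.
move=> h; apply: contrapT => /not_orP[].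
move=> /existsNP[S1 /not_implyP[sS1 /not_implyP[h1 /contrapT n1]]].
move=> /existsNP[S2 /not_implyP[sS2 /not_implyP[h2 /contrapT n2]]].
apply: (h _ (sigma_or sS1 sS2)) => U A e mA he hab.
  by have [hP|hP] := pselect (P U A e); [left; apply: h1|right; apply: h2].
by case=> [/(n1 _ _ _ mA he hab)|/(n2 _ _ _ mA he hab)].
Qed.

(** Dually, separating formulas for the two extensions of [b] combine by conjunction. *)
Lemma insep_decR a b P : insep a b -> insep a (pand b P) \/ insep a (pand b (pnot P)).
Proof.
move=> h; apply: contrapT => /not_orP[].
move=> /existsNP[S1 /not_implyP[sS1 /not_implyP[h1 /contrapT n1]]].
move=> /existsNP[S2 /not_implyP[sS2 /not_implyP[h2 /contrapT n2]]].
apply: (h _ (sigma_and sS1 sS2)) => U A e mA he hab.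
  by split; [exact: h1|exact: h2].
case=> s1 s2.
have [hP|hP] := pselect (P U A e); first exact: (n1 _ _ _ mA he (conj hab hP) s1).
exact: (n2 _ _ _ mA he (conj hab hP) s2).
Qed.

(** If [S'] separated the new pair, the conjunction of [S] and [S'] would separate the old one. This
    makes $\Sigma^1_1$ facts pass from the left model to the right one. *)
Lemma insep_transfer a b S : insep a b -> sigma T S -> entails a S ->
  insep a (pand b (pdbl S)).
Proof.
move=> h sS aS S' sS' aS' n; apply: (h _ (sigma_and sS sS')) => U A e mA he hab.
  by split; [exact: aS|exact: aS'].
by case=> s s'; exact: (n _ _ _ mA he (conj hab s) s').
Qed.

Lemma agree_upd N U (e : assignment U) c a : N <= c -> agree N e (upd e c a).
Proof. by move=> h; split=> // x hx /=; rewrite ltn_eqF // (leq_trans hx). Qed.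

Lemma agree_updR N U (e : assignment U) n c R : N <= c -> agree N e (updR e (n := n) c R).
Proof.
move=> h; split=> // n' k _ hk; rewrite updR_other //.
by rewrite xpair_eqE negb_and orbC ltn_eqF // (leq_trans hk).
Qed.

(** A formula separating the new pair, quantified existentially over the fresh [c], separates the
    old one. *)
Lemma insep_witL a b P N c : insep a b -> supp N a -> supp N b -> N <= c ->
  entails a (fun U A e => exists2 i, dom A i & P U A (upd e c i)) ->
  insep (pand a P) b.
Proof.
move=> h sa sb hc hP S sS aS n; apply: (h _ (sigma_ex c sS)) => U A e mA he hab.
  have [i hi hPi] := hP _ _ _ mA he hab; exists i => //.
  apply: aS => //; first exact: upd_in.
  by split=> //; apply: sa hab; exact: agree_upd.
case=> i hi hS; apply: (n _ _ _ mA (upd_in c he hi)) => //.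
by apply: sb hab; exact: agree_upd.
Qed.

Lemma dbl_updR_even U (e : assignment U) n c R :
  dbl (updR e (n := n) c.*2 R) = updR (dbl e) c R.
Proof.
apply: assignment_eq => // n' k.
have [[-> ->]|ne] := eqVneq (n', k) (n, c).
  by rewrite updR_same [LHS]updR_same.
by rewrite updR_other // [LHS]updR_other // xpair_eqE (inj_eq double_inj).
Qed.

Lemma dbl_updR_odd U (e : assignment U) n c R :
  dbl (updR e (n := n) c.*2.+1 R) = dbl e.
Proof.
apply: assignment_eq => // n' k; rewrite [LHS]updR_other // xpair_eqE negb_and.
by apply/orP; right; apply/eqP => /(congr1 odd); rewrite /= !odd_double.
Qed.

(** The same with an existential relation quantifier. The name [c] on the left is [c.*2] on the
    right, which is fresh for [b] too. *)
Lemma insep_witLR a b P N n c : insep a b -> supp N a -> supp N b -> N <= c ->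
  entails a (fun U A e => exists2 R, rels A n R & P U A (updR e c R)) ->
  insep (pand a P) b.
Proof.
move=> h sa sb hc hP S sS aS hn; apply: (h _ (sigma_exR n c sS)) => U A e mA he hab.
  have [i hi hPi] := hP _ _ _ mA he hab; exists i => //.
  apply: aS => //; first exact: updR_in.
  by split=> //; apply: sa hab; exact: agree_updR.
case=> i hi hS; apply: (hn _ _ (updR e c.*2 i) mA); first exact: updR_in.
  by apply: sb hab; apply: agree_updR; rewrite (leq_trans hc) // -addnn leq_addr.
by rewrite /pdbl dbl_updR_even.
Qed.

Hypothesis hAC : extends_Sigma11_AC0 T.

(** The new individual belongs to the left model as well, where it is arbitrary: [a] entails the
    separating formula for all values of [c], and the universal closure, which is $\Sigma^1_1$ by
    choice, separates the old pair. *)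
Lemma insep_witR a b P N c : insep a b -> supp N a -> supp N b -> N <= c ->
  entails b (fun U A e => exists2 i, dom A i & P U A (upd e c i)) ->
  insep a (pand b P).
Proof.
move=> h sa sb hc hP S sS aS n; apply: (h _ (sigma_all hAC c sS)) => U A e mA he hab.
  move=> i hi; apply: aS => //; first exact: upd_in.
  by apply: sa hab; exact: agree_upd.
move=> hS; have [i hi hPi] := hP _ _ _ mA he hab.
apply: (n _ _ (upd e c i) mA) (hS i hi); first exact: upd_in.
by split=> //; apply: sb hab; exact: agree_upd.
Qed.

(** No [pdbl S] reads an odd name, so a formula separating the new pair already separates the old
    one. *)
Lemma insep_witRR a b P N n c : insep a b -> supp N b -> N <= c.*2.+1 ->
  entails b (fun U A e => exists2 R, rels A n R & P U A (updR e c.*2.+1 R)) ->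
  insep a (pand b P).
Proof.
move=> h sb hc hP S sS aS hn; apply: (h _ sS aS) => U A e mA he hab hS.
have [R hR hPR] := hP _ _ _ mA he hab.
apply: (hn _ _ (updR e c.*2.+1 R) mA); first exact: updR_in.
  by split=> //; apply: sb hab; exact: agree_updR.
by rewrite /pdbl dbl_updR_odd.
Qed.

Definition nsetR g n (k c : nat) : nat -> nat -> nat := @nupdR (fun _ => nat) g n k c.

Lemma ren_nupd f g U (e : assignment U) x c :
  ren (nupd f x c) g e = upd (ren f g e) x (ival e c).
Proof. by apply: assignment_eq => //; apply: funext => y /=; rewrite /nupd; case: eqP. Qed.

Lemma ren_nsetR f g U (e : assignment U) n k c :
  ren f (nsetR g n k c) e = updR (ren f g e) k (rval e n c).
Proof.
apply: assignment_eq => // n' k' /=; rewrite /nsetR /nupdR.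
by case: dfwithP => [|j ne]; rewrite ?dfwith_in ?dfwith_out //; case: eqP.
Qed.

Record state := State { lstate : mpred L; rstate : mpred L }.

Definition good s := insep (lstate s) (rstate s) /\
  exists N, supp N (lstate s) /\ supp N (rstate s).

Definition refines (a' a : mpred L) : Prop := forall U (A : henkin L U) e, a' U A e -> a U A e.

Lemma entails_refines a a' P : refines a' a -> entails a P -> entails a' P.
Proof. by move=> h1 h2 U A e mA he /h1; exact: h2. Qed.

Definition extends s' s := refines (lstate s') (lstate s) /\ refines (rstate s') (rstate s).

Lemma refines_pand a P : refines (pand a P) a.
Proof. by move=> U A e []. Qed.

Lemma refines_refl a : refines a a.
Proof. by []. Qed.

Lemma entails_pand a P : entails (pand a P) P.
Proof. by move=> U A e _ _ []. Qed.

(** Names put for variables could be captured by the quantifiers of [p], hence the recourse to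
    substitution. *)
Lemma sigma_clo p f g : first_order p -> sigma T (clo p f g).
Proof.
move=> fp; have fp' : first_order (noeq p) by rewrite first_order_noeq.
have [||q fq hq] := @first_order_subst_eqfree L 0
  (fun U e n k => rval e n (g n k)) _ _ (noeq p) fp' (eqfree_noeq p) f.
- by [].
- by move=> n k ts; exists (FRel (g n k) ts).
apply: (sigma_ext (sigma_fo T fq)) => U A e _ he; rewrite hq //.
by apply: (sat_noeq p (e := ren f g e)); exact: ren_in.
Qed.

Definition witness (a : mpred L) p f g : Prop := match p with
  | FEx x q => exists i, entails a (clo q (nupd f x i) g)
  | FExR n k q => exists K, entails a (clo q f (nsetR g n k K))
  | _ => True
  end.

(** A first-order decision on the left is imposed on the right, whichever way it goes; this makes
    the atomic facts of the two limit models agree. *)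
Definition decidesL s p f g :=
  [/\ entails (lstate s) (clo p f g), witness (lstate s) p f g &
     first_order p -> entails (rstate s) (pdbl (clo p f g))] \/
  (entails (lstate s) (pnot (clo p f g)) /\
     (first_order p -> entails (rstate s) (pdbl (pnot (clo p f g))))).

Definition decidesR s p f g :=
  (entails (rstate s) (clo p f g) /\ witness (rstate s) p f g) \/
  entails (rstate s) (pnot (clo p f g)).

Lemma good_andL a b P N : insep (pand a P) b -> supp N P -> good (State a b) ->
  good (State (pand a P) b).
Proof.
move=> h hP [_ [M [ha hb]]]; split=> //; exists (maxn M N); split; first exact: supp_pand.
by apply: supp_leq hb; rewrite leq_maxl.
Qed.

Lemma good_andR a b P N : insep a (pand b P) -> supp N P -> good (State a b) ->
  good (State a (pand b P)).
Proof.
move=> h hP [_ [M [ha hb]]]; split=> //; exists (maxn M N); split; last exact: supp_pand.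
by apply: supp_leq ha; rewrite leq_maxl.
Qed.

Lemma clo_fresh f g q x c U (A : henkin L U) e i : (forall z, z < bound q -> f z < c) ->
  sat A (upd (ren f g e) x i) q -> clo q (nupd f x c) g A (upd e c i).
Proof.
move=> hf; rewrite /clo ren_nupd /= eqxx; apply: agree_sat; split=> // z hz /=.
by rewrite (ltn_eqF (hf z hz)).
Qed.

Lemma clo_freshR f g q n k c U (A : henkin L U) e (R : set (n.+1.-tuple U)) :
  (forall n' k', n' < bound q -> k' < bound q -> g n' k' < c) ->
  sat A (updR (ren f g e) k R) q -> clo q f (nsetR g n k c) A (updR e c R).
Proof.
move=> hg; rewrite /clo ren_nsetR updR_same; apply: agree_sat; split=> // n' k' hn hk.
have [[-> ->]|ne] := eqVneq (n', k') (n, k); first by rewrite !updR_same.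
rewrite !updR_other // [RHS]updR_other //.
by rewrite xpair_eqE negb_and orbC (ltn_eqF (hg _ _ hn hk)).
Qed.

Lemma step_witnessL a b p f g : good (State a b) -> entails a (clo p f g) ->
  exists a', [/\ good (State a' b), refines a' a & witness a' p f g].
Proof.
move=> gs; have [his [N [sa sb]]] := gs.
case: p => [s t|n k l|n k ts|n C ts|q|q q'|x q|n k q] ap;
  try by exists a; split=> //; exact: refines_refl.
  (* [c] is beyond the supports of both predicates and beyond every name put for a variable of
     [q]. *)
  have [N1 h1] := below_bounded f (bound q); pose c := maxn N N1.
  have [M sM] := supp_clo q (nupd f x c) g.
  exists (pand a (clo q (nupd f x c) g)); split; last by exists c; exact: entails_pand.
    apply: good_andL sM gs; apply: (insep_witL (c := c) his sa sb); first exact: leq_maxl.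
    move=> U A e mA he /(ap _ _ _ mA he) [i hi hs]; exists i => //.
    by apply: clo_fresh => // z /h1 hz; rewrite leq_max hz orbT.
  exact: refines_pand.
have [N1 h1] := below_bounded2 g (bound q); pose c := maxn N N1.
have [M sM] := supp_clo q f (nsetR g n k c).
exists (pand a (clo q f (nsetR g n k c))); split; last by exists c; exact: entails_pand.
  apply: good_andL sM gs; apply: (insep_witLR (c := c) his sa sb); first exact: leq_maxl.
  move=> U A e mA he /(ap _ _ _ mA he) [R hR hs]; exists R => //.
  by apply: clo_freshR => // n' k' hn hk; rewrite leq_max (h1 n' k') ?orbT.
exact: refines_pand.
Qed.

Lemma step_witnessR a b p f g : good (State a b) -> entails b (clo p f g) ->
  exists b', [/\ good (State a b'), refines b' b & witness b' p f g].
Proof.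
move=> gs; have [his [N [sa sb]]] := gs.
case: p => [s t|n k l|n k ts|n C ts|q|q q'|x q|n k q] ap;
  try by exists b; split=> //; exact: refines_refl.
  have [N1 h1] := below_bounded f (bound q); pose c := maxn N N1.
  have [M sM] := supp_clo q (nupd f x c) g.
  exists (pand b (clo q (nupd f x c) g)); split; last by exists c; exact: entails_pand.
    apply: good_andR sM gs; apply: (insep_witR (c := c) his sa sb); first exact: leq_maxl.
    move=> U A e mA he /(ap _ _ _ mA he) [i hi hs]; exists i => //.
    by apply: clo_fresh => // z /h1 hz; rewrite leq_max hz orbT.
  exact: refines_pand.
have [N1 h1] := below_bounded2 g (bound q); pose c := maxn N N1.
(* The odd name inherits its freshness from [c] and stays invisible to the left side. *)
have hc : c <= c.*2.+1 by rewrite -addnn -addnS leq_addr.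
have [M sM] := supp_clo q f (nsetR g n k c.*2.+1).
exists (pand b (clo q f (nsetR g n k c.*2.+1))).
split; last by exists c.*2.+1; exact: entails_pand.
  apply: good_andR sM gs; apply: (insep_witRR (c := c) his sb).
    by rewrite (leq_trans _ hc) // leq_maxl.
  move=> U A e mA he /(ap _ _ _ mA he) [R hR hs]; exists R => //.
  apply: clo_freshR => // n' k' hn hk; rewrite (leq_trans _ hc) //.
  by rewrite leq_max (h1 n' k') ?orbT.
exact: refines_pand.
Qed.

Lemma step_transfer a b P N : good (State a b) -> sigma T P -> supp N P -> entails a P ->
  good (State a (pand b (pdbl P))).
Proof.
move=> gs sP hP aP; apply: good_andR (supp_pdbl hP) (gs).
by apply: insep_transfer => //; case: gs.
Qed.

Lemma step_decidesL s p f g : good s ->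
  exists s', [/\ good s', extends s' s & decidesL s' p f g].
Proof.
case: s => a b gs; have [his _] := gs; have [N sN] := supp_clo p f g.
have fsigma P : supp N P -> (first_order p -> sigma T P) -> forall a' b', good (State a' b') ->
    entails a' P -> exists b'', [/\ good (State a' b''), refines b'' b' &
      first_order p -> entails b'' (pdbl P)].
  move=> sP fP a' b' gs' aP; have [fp|nfp] := boolP (first_order p); last first.
    by exists b'; split=> //; exact: refines_refl.
  exists (pand b' (pdbl P)); split; last by move=> _; exact: entails_pand.
    exact: (step_transfer gs' (fP fp) sP).
  exact: refines_pand.
case: (insep_decL (clo p f g) his) => h.
  have [a' [ga ra wa]] := step_witnessL (good_andL h sN gs) (@entails_pand a (clo p f g)).
  have ea := entails_refines ra (@entails_pand a (clo p f g)).
  have [b' [gb rb tb]] := fsigma _ sN (@sigma_clo p f g) _ _ ga ea.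
  exists (State a' b'); split=> //; last by left.
  by split=> // U A e /ra [].
have ea := @entails_pand a (pnot (clo p f g)).
have [||b' [gb rb tb]] := fsigma (pnot (clo p f g)) _ _ _ _ (good_andL h (supp_pnot sN) gs) ea.
- exact: supp_pnot.
- by move=> fp; exact: (@sigma_clo (FNot p) f g fp).
exists (State (pand a (pnot (clo p f g))) b'); split=> //; last by right.
by split=> // U A e [].
Qed.

Lemma step_decidesR s p f g : good s ->
  exists s', [/\ good s', extends s' s & decidesR s' p f g].
Proof.
case: s => a b gs; have [his _] := gs; have [N sN] := supp_clo p f g.
case: (insep_decR (clo p f g) his) => h.
  have [b' [gb rb wb]] := step_witnessR (good_andR h sN gs) (@entails_pand b (clo p f g)).
  exists (State a b'); split=> //; first by split=> // U A e /rb [].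
  by left; split=> //; apply: entails_refines rb (@entails_pand b (clo p f g)).
exists (State a (pand b (pnot (clo p f g)))); split.
- exact: good_andR (supp_pnot sN) gs.
- by split=> //; exact: refines_pand.
- by right; exact: entails_pand.
Qed.

(* Codes of renamings, to have countably many of them. *)
Definition list_fun (l : seq nat) : nat -> nat := nth 0 l.
Definition list_fun2 (l : seq (seq nat)) : nat -> nat -> nat := fun n => nth 0 (nth [::] l n).

Definition decides (left : bool) s p f g :=
  if left then decidesL s p f g else decidesR s p f g.

Lemma clo_local p f g f' g' U (A : henkin L U) e :
  (forall x, x < bound p -> f x = f' x) ->
  (forall n k, n < bound p -> k < bound p -> g n k = g' n k) ->
  clo p f g A e <-> clo p f' g' A e.
Proof.
by move=> h1 h2; apply: sat_agree; split=> [x hx|n k hn hk] /=; rewrite ?h1 ?h2.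
Qed.

Lemma entails_ext a P P' : (forall U (A : henkin L U) e, P U A e <-> P' U A e) ->
  entails a P -> entails a P'.
Proof. by move=> h aP U A e mA he ha; apply/h; exact: aP. Qed.

Lemma decides_local l s p f g f' g' :
  (forall x, x < bound p -> f x = f' x) ->
  (forall n k, n < bound p -> k < bound p -> g n k = g' n k) ->
  decides l s p f g -> decides l s p f' g'.
Proof.
move=> h1 h2.
have E U (A : henkin L U) e : clo p f g A e <-> clo p f' g' A e by exact: clo_local.
have En U (A : henkin L U) e : pnot (clo p f g) A e <-> pnot (clo p f' g') A e.
  by have := E U A e; rewrite /pnot; tauto.
have W a : witness a p f g -> witness a p f' g'.
  case: p h1 h2 {E En} => //= [x q|n k q] h1 h2 [i hi]; exists i;
    apply: entails_ext hi => U A e; apply: clo_local => [y hy|n' k' hn hk].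
  - by rewrite /nupd h1 // leq_max hy orbT.
  - by rewrite h2 // leq_max ?hn ?hk orbT.
  - by rewrite h1 // leq_max hy orbT.
  - have e0 : forall m, m < bound q -> forall k, k < bound q -> g m k = g' m k.
      by move=> m hm j hj; rewrite h2 // leq_max ?hm ?hj orbT.
    rewrite /nsetR /nupdR; case: dfwithP hn => [hn|m ne hn];
      rewrite ?dfwith_in ?dfwith_out // ?e0 //.
have D P P' : (forall U (A : henkin L U) e, P U A e <-> P' U A e) ->
  forall U (A : henkin L U) e, pdbl P A e <-> pdbl P' A e by move=> h U A e; exact: h.
case: l => /=.
  case=> [[ea wa tb]|[ea tb]]; [left|right]; split.
  - exact: entails_ext ea.
  - exact: W.
  - by move=> /tb; apply: entails_ext; exact: D.
  - exact: entails_ext ea.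
  - by move=> /tb; apply: entails_ext; exact: D.
case=> [[ea wa]|ea]; [left; split|right].
- exact: entails_ext ea.
- exact: W.
- exact: entails_ext ea.
Qed.

(** Stage [n] performs the task coded by [n]. A renaming matters only on the variables below the
    bound of the formula, so its restriction to a finite list is enough. *)
Lemma generic_chain (F : nat -> form L) s0 : good s0 -> exists st : nat -> state,
  [/\ st 0 = s0, (forall s, good (st s)), (forall s, extends (st s.+1) (st s)) &
   forall l m f g, exists s, decides l (st s) (F m) f g].
Proof.
move=> g0; pose task := (bool * nat * (seq nat) * (seq (seq nat)))%type.
have /choice[step hstep] : forall x : {s | good s} * task, exists s' : {s | good s},
    extends (sval s') (sval x.1) /\
    decides x.2.1.1.1 (sval s') (F x.2.1.1.2) (list_fun x.2.1.2) (list_fun2 x.2.2).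
  move=> [[s gs] [[[l m] fl] gl]] /=; case: l => /=.
    have [s' [gs' es ds]] := step_decidesL (F m) (list_fun fl) (list_fun2 gl) gs.
    by exists (exist _ s' gs').
  have [s' [gs' es ds]] := step_decidesR (F m) (list_fun fl) (list_fun2 gl) gs.
  by exists (exist _ s' gs').
pose next n (x : {s | good s}) := if unpickle n is Some t then step (x, t) else x.
pose st := fix st n : {s | good s} := if n is n'.+1 then next n' (st n') else exist _ s0 g0.
exists (fun n => sval (st n)); split=> //.
- by move=> s; exact: svalP.
- move=> s /=; rewrite /next; case: unpickle => [t|]; last by split; exact: refines_refl.
  by case: (hstep (st s, t)).
- move=> l m f g; pose N := bound (F m).
  pose t : task := (l, m, mkseq f N, mkseq (fun n => mkseq (g n) N) N).
  exists (pickle t).+1 => /=; rewrite /next pickleK.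
  case: (hstep (st (pickle t), t)) => _; apply: decides_local => /=.
    by move=> x hx; rewrite /list_fun nth_mkseq.
  by move=> n k hn hk; rewrite /list_fun2 !nth_mkseq.
Qed.

End Closures.

(** * The generic pair of models *)

Section Limit.
Context (L : signature) (T : set (form L)).
Implicit Types (p q : form L) (P : mpred L).

Definition occurs (c : const L) p : Prop := match p with
  | FEq s t => s = TCst c \/ t = TCst c
  | FRel n k ts => exists i, tnth ts i = TCst c
  | FSym n C ts => exists i, tnth ts i = TCst c
  | _ => False
  end.

Definition subclosed (F : form L -> Prop) : Prop := forall p, F p -> match p with
  | FREq _ _ _ => False
  | FNot q => F q
  | FAnd q q' => F q /\ F q'
  | FEx x q => F q
  | FExR n k q => F q
  | _ => True
  end.

Context (u : nat -> mpred L).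
Hypothesis u_refines : forall s, refines (u s.+1) (u s).
Hypothesis u_cons : forall s, ~ entails T (u s) (fun U A e => False).

Definition lim P : Prop := exists s, entails T (u s) P.

Lemma u_mono s s' : s <= s' -> refines (u s') (u s).
Proof.
elim: s' => [|s' IH]; first by rewrite leqn0 => /eqP ->; exact: refines_refl.
rewrite leq_eqVlt => /orP[/eqP ->|/IH h]; first exact: refines_refl.
by move=> U A e /u_refines; exact: h.
Qed.

Lemma lim_mono P P' : lim P ->
  (forall U (A : henkin L U) e, model A T -> assignment_in A e -> P U A e -> P' U A e) ->
  lim P'.
Proof. by move=> [s hs] h; exists s => U A e mA he hu; apply: h => //; exact: hs. Qed.

Lemma lim_and P P' : lim P -> lim P' -> lim (pand P P').
Proof.
move=> [s hs] [s' hs']; exists (maxn s s'); split.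
  by apply: hs => //; apply: u_mono H1; rewrite leq_maxl.
by apply: hs' => //; apply: u_mono H1; rewrite leq_maxr.
Qed.

Lemma lim_cons P : lim P -> lim (pnot P) -> False.
Proof.
move=> h1 h2; have [s hs] := lim_and h1 h2; apply: (u_cons (s := s)) => U A e mA he hu.
by case: (hs _ _ _ mA he hu).
Qed.

Lemma lim_true P :
  (forall U (A : henkin L U) e, model A T -> assignment_in A e -> P U A e) -> lim P.
Proof. by move=> h; exists 0 => U A e mA he _; exact: h. Qed.

Lemma lim_all n (P : 'I_n -> mpred L) : (forall i, lim (P i)) ->
  lim (fun U A e => forall i, P i U A e).
Proof.
elim: n P => [|n IH] P h; first by apply: lim_true => U A e _ _ [].
have h1 := IH (fun i => P (lift ord0 i)) (fun i => h (lift ord0 i)).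
apply: (lim_mono (lim_and (h ord0) h1)) => U A e _ _ [h2 h3] i.
by case: (unliftP ord0 i) => [j ->|->].
Qed.

Context (r : nat -> nat) (cst : const L -> nat).
Context (sy : forall n, rsym L n -> set (n.+1.-tuple nat)).
Context (F : form L -> Prop).
Hypothesis F_sub : subclosed F.
Hypothesis rE : forall i j, r i = r j <-> lim (fun U A e => ival e i = ival e j).
Hypothesis cstE : forall p c, F p -> occurs c p ->
  lim (fun U A e => ival e (cst c) = cstI A c).
Hypothesis dec : forall p f g, F p ->
  (lim (clo p f g) /\ match p with
     | FEx x q => exists i, lim (clo q (nupd f x i) g)
     | FExR n k q => exists K, lim (clo q f (nsetR g n k K))
     | _ => True
     end) \/ lim (pnot (clo p f g)).

Lemma lim_term p f g t : F p -> (forall c, t = TCst c -> occurs c p) ->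
  lim (fun U A e => ival e (nval cst f t) = tval A (ren f g e) t).
Proof.
move=> hp; case: t => [x _|c /(_ c erefl) oc] /=; first exact: lim_true.
exact: cstE oc.
Qed.

Lemma lim_terms p f g n (ts : n.-tuple (term L)) : F p ->
  (forall c, (exists i, tnth ts i = TCst c) -> occurs c p) ->
  lim (fun U A e => map_tuple (ival e) (map_tuple (nval cst f) ts) =
                    map_tuple (tval A (ren f g e)) ts).
Proof.
move=> hp h; have hl (i : 'I_n) : lim (fun U A e =>
    ival e (nval cst f (tnth ts i)) = tval A (ren f g e) (tnth ts i)).
  by apply: lim_term hp _ => c hc; apply: h; exists i.
apply: (lim_mono (lim_all hl)) => U A e _ _ he.
by apply: eq_from_tnth => i; rewrite !tnth_map.
Qed.

Lemma lim_eqset P P' Q : lim Q ->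
  (forall U (A : henkin L U) e, model A T -> assignment_in A e ->
    Q U A e -> P U A e <-> P' U A e) -> lim P <-> lim P'.
Proof.
move=> hQ h; split=> hP; apply: (lim_mono (lim_and hQ hP)) => U A e mA he [h1 h2];
  by apply/h.
Qed.

Lemma lim_clo_sym n (C : rsym L n) ts f g : F (FSym C ts) ->
  lim (fun U A e => symI A C (map_tuple (ival e) (map_tuple (nval cst f) ts))) <->
  lim (clo (FSym C ts) f g).
Proof.
move=> hp; have h := @lim_terms _ f g _ ts hp (fun c h => h).
by apply: (lim_eqset h) => U A e _ _; rewrite /clo /= => ->.
Qed.

Definition lim_app n (K : nat) : set (n.+1.-tuple nat) :=
  [set t | lim (fun U A e => rval e n K (map_tuple (ival e) t))].

Hypothesis rK : forall i, r (r i) = r i.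

Lemma lim_repr n (t : n.-tuple nat) :
  lim (fun U A e => map_tuple (ival e) (map_tuple r t) = map_tuple (ival e) t).
Proof.
have h (i : 'I_n) : lim (fun U A e => ival e (r (tnth t i)) = ival e (tnth t i)).
  by apply/rE.
apply: (lim_mono (lim_all h)) => U A e _ _ he.
by apply: eq_from_tnth => i; rewrite !tnth_map.
Qed.

Lemma lim_app_r n K (t : n.+1.-tuple nat) : lim_app K (map_tuple r t) <-> lim_app K t.
Proof. by apply: (lim_eqset (lim_repr t)) => U A e _ _ ->. Qed.

Hypothesis syE : forall n (C : rsym L n) ts f, F (FSym C ts) ->
  sy C (map_tuple (nval cst f) ts) <->
  lim (fun U A e => symI A C (map_tuple (ival e) (map_tuple (nval cst f) ts))).

(** Consistency of the limit together with the decision of all instances gives the clause for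
    negation; the recorded witnesses give the clauses for the quantifiers. *)
Lemma lim_tarski : tarski r cst sy (NR := fun _ => nat) lim_app F
  (fun p f g => lim (clo p f g)).
Proof.
move=> p hp f g; have := F_sub hp; have := @dec p f g hp; case: p hp => /=
  [s t|n k l|n k ts|n C ts|q|q q'|x q|n k q] hp hdec hsub //.
- have h1 := lim_term f g hp (fun c (E : s = TCst c) => or_introl E).
  have h2 := lim_term f g hp (fun c (E : t = TCst c) => or_intror E).
  rewrite rE; apply: (lim_eqset (lim_and h1 h2)) => U A e _ _ [E1 E2].
  by rewrite /clo /= E1 E2.
- have h := @lim_terms _ f g _ ts hp (fun c h => h).
  by symmetry; apply: (lim_eqset h) => U A e _ _; rewrite /clo /= => ->.
- by rewrite (syE f hp) (lim_clo_sym f g hp).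
- split=> //; split=> [h1 h2|h]; first by apply: lim_cons h2 h1.
  by case: (@dec q f g hsub) => [[]|].
- case: hsub => hq hq'; split=> //; split=> [h|[h1 h2]]; last exact: lim_and.
  by split; apply: (lim_mono h) => U A e _ _ [].
- split=> //; split=> [h|[i h]].
    by case: hdec => [[_]|hn] //; case: (lim_cons h hn).
  apply: (lim_mono h) => U A e _ he; rewrite /clo ren_nupd => hs.
  by exists (ival e i) => //; case: he.
- split=> //; split=> [h|[K h]].
    by case: hdec => [[_]|hn] //; case: (lim_cons h hn).
  apply: (lim_mono h) => U A e _ he; rewrite /clo => hs.
  exists (rval e n K); first by case: he.
  by rewrite -ren_nsetR.
Qed.

End Limit.

Lemma representatives (X : Type) (E : X -> X -> Prop) :
  (forall i, E i i) -> (forall i j, E i j -> E j i) ->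
  (forall i j k, E i j -> E j k -> E i k) ->
  exists r : X -> X, (forall i j, r i = r j <-> E i j) /\ (forall i, r (r i) = r i).
Proof.
move=> Er Es Et.
have [r rE] : exists r : X -> X, forall i, E i (r i) /\ forall j, E i j -> r i = r j.
  exists (fun i => sval (cid (ex_intro (E i) i (Er i)))) => i; split; first by case: cid.
  (* Equivalent points have the same class as a predicate, and by proof irrelevance the element
     chosen depends on the class only. *)
  move=> j h; have EE : E i = E j.
    by apply: funext => k; apply: propext; split; apply: Et => //; exact: Es.
  move: (Er i) (Er j) => ri rj.
  move: (ex_intro _ i ri) (ex_intro _ j rj); rewrite EE => a b.
  by rewrite (Prop_irrelevance a b).
have rE' i j : r i = r j <-> E i j.
  split=> [h|]; last by case: (rE i) => _; apply.
  by apply: Et (Es _ _ (proj1 (rE j))); rewrite -h; case: (rE i).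
by exists r; split=> // i; apply/rE'/Es; case: (rE i).
Qed.

(** * The generic pair for a countable set of formulas *)

Section Construction.
Context (L : signature) (T : set (form L)).
Hypothesis hAC : extends_Sigma11_AC0 T.
Implicit Types (p q : form L) (P : mpred L).

(** The first two clauses cause equality of individuals and membership in named relations to be
    decided on the left and transferred; the witness for the third gives a name to each constant
    that occurs. *)
Definition rich (F : form L -> Prop) : Prop :=
  [/\ F (FEq (TVar 0) (TVar 1)),
      (forall n, F (FRelv L 0 (iota_tuple n.+1 0))) &
      (forall p c, F p -> occurs c p -> F (FEx 0 (FEq (TVar 0) (TCst c))))].

(** As atomic facts agree on both sides, the classes of names, the constants and the symbols are
    read off the left limit and serve on the right as well; this makes the domains equal. *)
Lemma generic_pair (F : nat -> form L) Q :
  subclosed (range F) -> rich (range F) -> range F Q ->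
  ~ sigma T (fun U A e => sat A e Q) ->
  exists (A B : henkin L nat) e, [/\ substructure A B, dom A = dom B, assignment_in A e,
    sat A e Q /\ ~ sat B e Q &
    forall p, range F p -> proves T p -> valid A p /\ valid B p].
Proof.
move=> Fsub [Feq Frel Fcst] FQ nQ.
pose a0 : mpred L := fun U A e => sat A e Q.
have g0 : good T (State a0 (pdbl (pnot a0))).
  have s0 : supp (bound Q) a0 by move=> U A e e' h; exact: agree_sat.
  split; last first.
    exists (bound Q).*2; split; last exact: supp_pdbl (supp_pnot s0).
    by apply: supp_leq s0; rewrite -addnn leq_addr.
  move=> S sS aS nS; apply: nQ; apply: (sigma_ext sS) => U A e mA he; split; last exact: aS.
  move=> hS; apply: contrapT => nq.
  pose e' := ren id (fun _ k => k./2) e.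
  have E : dbl e' = e by apply: assignment_eq => // n k /=; rewrite doubleK.
  have := nS U A e' mA; rewrite /= /pnot /pdbl E; apply=> //.
  exact: ren_in.
have [st [st0 sg sext sdec]] := generic_chain hAC F g0.
pose a s := lstate (st s); pose b s := rstate (st s).
have ra s : refines (a s.+1) (a s) by case: (sext s).
have rb s : refines (b s.+1) (b s) by case: (sext s).
have ca s : ~ entails T (a s) (fun U A e => False) by case: (sg s) => /insep_consL.
have cb s : ~ entails T (b s) (fun U A e => False) by case: (sg s) => /insep_consR.
have deca p f g : range F p -> (lim T a (clo p f g) /\ match p with
     | FEx x q => exists i, lim T a (clo q (nupd f x i) g)
     | FExR n k q => exists K, lim T a (clo q f (nsetR g n k K))
     | _ => True
     end) \/ lim T a (pnot (clo p f g)).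
  case=> m _ <-; have [s [[h1 h2 _]|[h1 _]]] := sdec true m f g; [left|right]; last by exists s.
  split; first by exists s.
  by case: (F m) h2 => // [x q|n k q] [i hi]; exists i, s.
have decb p f g : range F p -> (lim T b (clo p f g) /\ match p with
     | FEx x q => exists i, lim T b (clo q (nupd f x i) g)
     | FExR n k q => exists K, lim T b (clo q f (nsetR g n k K))
     | _ => True
     end) \/ lim T b (pnot (clo p f g)).
  case=> m _ <-; have [s [[h1 h2]|h1]] := sdec false m f g; [left|right]; last by exists s.
  split; first by exists s.
  by case: (F m) h2 => // [x q|n k q] [i hi]; exists i, s.
have tra p f g : range F p -> first_order p ->
    lim T a (clo p f g) <-> lim T b (pdbl (clo p f g)).
  move=> [m _ <-] fo; have [s [[h1 _ /(_ fo) h2]|[h1 /(_ fo) h2]]] := sdec true m f g.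
    by split=> _; exists s.
  split=> h; first by case: (lim_cons ra ca h); exists s.
  by case: (lim_cons rb cb h); exists s.
have eqE i j : lim T a (fun U A e => ival e i = ival e j) <->
    lim T b (fun U A e => ival e i = ival e j).
  exact: (tra _ (nth 0 [:: i; j]) (fun _ _ => 0) Feq isT).
have [r [rE rK]] : exists r : nat -> nat, (forall i j, r i = r j <->
    lim T a (fun U A e => ival e i = ival e j)) /\ (forall i, r (r i) = r i).
  apply: representatives => [i|i j h|i j k h1 h2]; first exact: lim_true.
    by apply: (lim_mono h) => U A e _ _ ->.
  by apply: (lim_mono (lim_and ra h1 h2)) => U A e _ _ [-> ->].
have rEb i j : r i = r j <-> lim T b (fun U A e => ival e i = ival e j).
  by rewrite rE.
(* A constant that the limit equates with no name gets the arbitrary value 0; richness excludes this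
   for constants that occur in the enumerated formulas. *)
have /choice[cst hcst] c : exists i, forall i',
    lim T a (fun U A e => ival e i' = cstI A c) -> lim T a (fun U A e => ival e i = cstI A c).
  have [[i hi]|n] := pselect (exists i, lim T a (fun U A e => ival e i = cstI A c)).
    by exists i.
  by exists 0 => i' hi'; case: n; exists i'.
have csta p c : range F p -> occurs c p -> lim T a (fun U A e => ival e (cst c) = cstI A c).
  move=> hp hc; case: (@deca _ id (fun _ _ => 0) (Fcst _ _ hp hc)) => [[_ [i hi]]|hn].
    exact: hcst hi.
  case: (lim_cons ra ca _ hn); apply: lim_true => U A e _ _.
  by exists (cstI A c) => //; exact: cstI_dom.
have cstb p c : range F p -> occurs c p -> lim T b (fun U A e => ival e (cst c) = cstI A c).
  move=> hp hc; have Fc := Fsub _ (Fcst _ _ hp hc).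
  by have /(tra _ (fun _ => cst c) (fun _ _ => 0) Fc isT) := csta _ _ hp hc.
pose sy n (C : rsym L n) : set (n.+1.-tuple nat) :=
  [set t | lim T a (fun U A e => symI A C (map_tuple (ival e) t))].
have sy_r n (C : rsym L n) t : sy n C (map_tuple r t) <-> sy n C t.
  by apply: (lim_eqset ra (lim_repr ra rE rK t)) => U A e _ _ ->.
have syb n (C : rsym L n) ts f : range F (FSym C ts) -> sy n C (map_tuple (nval cst f) ts) <->
    lim T b (fun U A e => symI A C (map_tuple (ival e) (map_tuple (nval cst f) ts))).
  move=> hp; pose g := fun _ _ : nat => 0.
  rewrite (lim_clo_sym rb cstb f g hp) -[X in _ <-> X](tra _ f g hp isT).
  exact: (lim_clo_sym ra csta f g hp).
have ta := lim_tarski ra ca Fsub rE csta deca (fun n C ts f _ => iff_refl _) (sy := sy).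
have tb := lim_tarski rb cb Fsub rEb cstb decb syb.
pose K0 (n : nat) := 0.
pose A := truth_model 0 cst sy rK K0 (lim_app T a).
pose B := truth_model 0 cst sy rK K0 (lim_app T b).
(* The relation named [K] on the left is the one named [K.*2] on the right, whence the inclusion of
   the relations. *)
have appE n (K : nat) : @lim_app L T a n K = @lim_app L T b n K.*2.
  apply/seteqP; suff W t : @lim_app L T a n K t <-> @lim_app L T b n K.*2 t by split=> t /W.
  have := tra _ (nth 0 t) (fun _ _ => K) (Frel n) isT.
  have E U (A' : henkin L U) e k :
      clo (FRelv L 0 (iota_tuple n.+1 0)) (nth 0 t) (fun _ _ => k) A' e
      = rval e n k (map_tuple (ival e) t).
    rewrite /clo /= tvals_vars; congr (rval e n k _).
    apply: eq_from_tnth => i; rewrite !tnth_map (tnth_nth 0) (tnth_nth 0 t).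
    by rewrite nth_iota.
  move=> h; split=> hl.
    apply: (lim_mono
      (P := pdbl (clo (FRelv L 0 (iota_tuple n.+1 0)) (nth 0 t) (fun _ _ => K)))).
      by apply/h; apply: (lim_mono hl) => U A' e _ _; rewrite E.
    by move=> U A' e _ _; rewrite /pdbl E.
  apply: (lim_mono (P := clo (FRelv L 0 (iota_tuple n.+1 0)) (nth 0 t) (fun _ _ => K))).
    by apply/h; apply: (lim_mono hl) => U A' e _ _; rewrite /pdbl E.
  by move=> U A' e _ _; rewrite E.
have appar n K t := @lim_app_r L T a ra r rE rK n K t.
have appbr n K t := @lim_app_r L T b rb r rEb rK n K t.
exists A, B, (asg r (NR := fun=> nat) (lim_app T a) id (fun _ k => k)); split.
- by apply: truth_substructure => n K; exists K.*2; exact: appE.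
- by [].
- exact: asg_in.
- split.
    apply/(truth_lemma 0 rK sy_r K0 appar ta) => //; exists 0 => U A' e _ _.
    by rewrite /a st0; apply: agree_sat; split.
  have -> : asg r (NR := fun=> nat) (lim_app T a) id (fun _ k => k) =
      asg r (NR := fun=> nat) (lim_app T b) id (fun _ k => k.*2).
    by apply: assignment_eq => // n k /=; rewrite /ext appE.
  move/(truth_lemma 0 rK sy_r K0 appbr tb) => /(_ FQ) h; apply: (lim_cons rb cb h); exists 0.
  by move=> U A' e _ _; rewrite /b st0.
- move=> p Fp hp; split.
    apply: (truth_valid sy_r appar ta Fp) => f g; apply: lim_true => U A' e mA he.
    by apply: hp => //; exact: ren_in.
  apply: (truth_valid sy_r appbr tb Fp) => f g; apply: lim_true => U A' e mA he.
  by apply: hp => //; exact: ren_in.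
Qed.

End Construction.

(** * A countable rich set of formulas around a finite list *)

HB.instance Definition _ (L : signature) := gen_eqMixin (term L).
HB.instance Definition _ (L : signature) := gen_eqMixin (form L).

Section Enumeration.
Context (L : signature).
Implicit Types (p q : form L).

Fixpoint subs p : seq (form L) := p :: match p with
  | FNot q => subs q
  | FAnd q q' => subs q ++ subs q'
  | FEx _ q => subs q
  | FExR _ _ q => subs q
  | _ => [::]
  end.

Lemma mem_subs p : p \in subs p.
Proof. by case: p => *; rewrite /= mem_head. Qed.

Lemma eqfree_subs p q : eqfree p -> q \in subs p -> eqfree q.
Proof.
elim: p q => [s t|n k l|n k ts|n C ts|p IH|p IHp p' IHp'|x p IH|n k p IH] q //= ef;
  rewrite in_cons => /orP[/eqP -> //|]; rewrite ?in_nil //; try exact: IH.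
by case/andP: ef => e1 e2; rewrite mem_cat => /orP[]; [exact: IHp|exact: IHp'].
Qed.

Lemma subs_trans p q q' : q \in subs p -> q' \in subs q -> q' \in subs p.
Proof.
elim: p => [s t|n k l|n k ts|n C ts|p IH|p IHp p' IHp'|x p IH|n k p IH] /=;
  rewrite in_cons => /orP[/eqP -> //|]; rewrite ?in_nil // => h h'; rewrite in_cons;
  apply/orP; right; try exact: IH.
by move: h; rewrite !mem_cat => /orP[h|h]; rewrite ?(IHp h h') ?(IHp' h h') ?orbT.
Qed.

Definition aterms p : seq (term L) := match p with
  | FEq s t => [:: s; t]
  | FRel n k ts => ts
  | FSym n C ts => ts
  | _ => [::]
  end.

Definition cforms (t : term L) : seq (form L) :=
  if t is TCst c then [:: FEx 0 (FEq (TVar 0) (TCst c)); FEq (TVar 0) (TCst c)] else [::].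

Definition fragment (l : seq (form L)) : seq (form L) :=
  let b := flatten [seq subs p | p <- l] in
  b ++ flatten [seq flatten [seq cforms t | t <- aterms p] | p <- b].

(** Odd indices run through the membership atoms of all arities, even ones through the finite
    fragment; past its end, the default value supplies the equality atom that richness demands. *)
Definition enumeration (l : seq (form L)) (m : nat) : form L :=
  if odd m then FRelv L 0 (iota_tuple m./2.+1 0)
  else nth (FEq (TVar 0) (TVar 1)) (fragment l) m./2.

Lemma fragmentP l p : p \in fragment l <->
  (exists2 q, q \in l & p \in subs q) \/
  (exists2 c, p \in cforms (TCst c) &
     exists2 q, q \in l & exists2 p', p' \in subs q & TCst c \in aterms p').
Proof.
rewrite /fragment mem_cat; split=> [/orP[/flatten_mapP//|]|]; first by left.
  case/flatten_mapP => p' /flatten_mapP[q ql qs] /flatten_mapP[[//|c] ht hp].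
  by right; exists c => //; exists q => //; exists p'.
case=> [h|[c hp [q ql [p' p'q hc]]]]; apply/orP; [left|right]; first exact/flatten_mapP.
apply/flatten_mapP; exists p'; first by apply/flatten_mapP; exists q.
by apply/flatten_mapP; exists (TCst c).
Qed.

Lemma range_enumeration l p : range (enumeration l) p <->
  [\/ p \in fragment l, p = FEq (TVar 0) (TVar 1) |
      exists n, p = FRelv L 0 (iota_tuple n.+1 0)].
Proof.
split.
  case=> m _ <-; rewrite /enumeration; case: ifP => _; first by constructor 3; exists m./2.
  have [lt|ge] := ltnP m./2 (size (fragment l)); first by constructor 1; exact: mem_nth.
  by rewrite nth_default //; constructor 2.
case=> [hp|->|[n ->]].
- exists (index p (fragment l)).*2 => //.
  by rewrite /enumeration odd_double doubleK nth_index.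
- exists (size (fragment l)).*2 => //.
  by rewrite /enumeration odd_double doubleK nth_default.
- exists n.*2.+1 => //.
  by rewrite /enumeration /= odd_double /= uphalf_double.
Qed.

Lemma occurs_aterms c p : occurs c p -> TCst c \in aterms p.
Proof.
case: p => //= [s t|n k ts|n C ts].
- by case=> ->; rewrite !in_cons eqxx ?orbT.
- by case=> i <-; exact: mem_tnth.
- by case=> i <-; exact: mem_tnth.
Qed.

Lemma subclosed_enumeration l : all (@eqfree L) l -> subclosed (range (enumeration l)).
Proof.
move=> /allP efl p /range_enumeration[
  /fragmentP[[q ql qs]|[c hp [q ql [p' p'q hc]]]]|->|[n ->]] //.
  have ef := eqfree_subs (efl _ ql) qs.
  have W p' : p' \in subs p -> range (enumeration l) p'.
    move=> h; apply/range_enumeration; constructor 1; apply/fragmentP; left.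
    by exists q => //; exact: subs_trans qs h.
  case: p ef W {qs} => //= [p|p p'|x p|n k p] _ W;
    try by apply: W; rewrite in_cons mem_subs orbT.
  by split; apply: W; rewrite in_cons mem_cat mem_subs ?orbT.
have H : p \in cforms (TCst c) := hp.
move: hp; rewrite /= !in_cons in_nil orbF => /orP[] /eqP -> //.
apply/range_enumeration; constructor 1; apply/fragmentP; right; exists c.
  by rewrite /= !in_cons eqxx orbT.
by exists q => //; exists p'.
Qed.

Lemma rich_enumeration l : rich (range (enumeration l)).
Proof.
split=> [|n|p c /range_enumeration].
- by apply/range_enumeration; constructor 2.
- by apply/range_enumeration; constructor 3; exists n.
- case=> [/fragmentP[[q ql qs]|[c' hp [q ql [p' p'q hc]]]]|->|[n ->]] oc.
  + apply/range_enumeration; constructor 1; apply/fragmentP; right; exists c.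
      by rewrite /= in_cons eqxx.
    by exists q => //; exists p => //; exact: occurs_aterms.
  + have <- : c' = c.
      by move: hp oc; rewrite /= !in_cons in_nil orbF => /orP[] /eqP -> //= [|[]].
    apply/range_enumeration; constructor 1; apply/fragmentP; right; exists c'.
      by rewrite /= in_cons eqxx.
    by exists q => //; exists p'.
  + by case: oc.
  + by case: oc => i; rewrite tnth_map.
Qed.

Lemma mem_enumeration l p : p \in l -> range (enumeration l) p.
Proof.
move=> h; apply/range_enumeration; constructor 1; apply/fragmentP; left.
by exists p => //; exact: mem_subs.
Qed.

Context (T : set (form L)).
Hypothesis hAC : extends_Sigma11_AC0 T.

Lemma valid_noeq U (A : henkin L U) p : valid A (noeq p) <-> valid A p.
Proof. by split=> h e he; apply/sat_noeq => //; exact: h. Qed.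

Lemma finite_pair (l : seq (form L)) Q : ~ sigma T (fun U A e => sat A e Q) ->
  exists (A B : henkin L nat) e, [/\ substructure A B, dom A = dom B, assignment_in A e,
    sat A e Q /\ ~ sat B e Q & forall p, p \in l -> T p -> valid A p /\ valid B p].
Proof.
move=> nQ; pose l' := [seq noeq p | p <- Q :: l].
have ef : all (@eqfree L) l' by apply/allP => _ /mapP[p _ ->]; exact: eqfree_noeq.
have FQ : range (enumeration l') (noeq Q) by apply: mem_enumeration; rewrite mem_head.
have nQ' : ~ sigma T (fun U A e => sat A e (noeq Q)).
  move=> sQ; apply: nQ; apply: (sigma_ext sQ) => U A e _ he; exact: sat_noeq.
have [A [B [e [sAB dAB he [h1 h2] h3]]]] :=
  generic_pair hAC (subclosed_enumeration ef) (rich_enumeration l') FQ nQ'.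
have heB : assignment_in B e.
  by case: he sAB => [he1 he2] [hd hr _ _]; split=> [x|n k]; [exact: hd|exact: hr].
have EA := sat_noeq Q he; have EB := sat_noeq Q heB.
exists A, B, e; split=> //; first by tauto.
move=> p pl Tp; rewrite -(valid_noeq A) -(valid_noeq B); apply: h3.
  by apply: mem_enumeration; apply: map_f; rewrite in_cons pl orbT.
by move=> U M mM; apply/valid_noeq; exact: mM.
Qed.

End Enumeration.

(** * Ultraproducts *)

Section Ultraproduct.
Context (L : signature) (U I : Type) (D : set_system I) (UD : UltraFilter D).
Context (A : I -> henkin L U).
Implicit Types (p q : form L).

(** Names are the elements of the product of the domains; the quotient modulo [D] is formed by the
    representatives that [r] picks. *)
Definition uname : Type := {f : I -> U | forall i, dom (A i) (f i)}.

Definition Uname (f : I -> U) (hf : forall i, dom (A i) (f i)) : uname := exist _ f hf.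

Definition ucst (c : const L) : uname :=
  @Uname (fun i => cstI (A i) c) (fun i => cstI_dom (A i) c).

Definition uproj i (h : uname) : U := sval h i.

Definition usym n (C : rsym L n) : set (n.+1.-tuple uname) :=
  [set t | D [set i | symI (A i) C (map_tuple (uproj i) t)]].

Lemma ultra_not (X : set I) : D (~` X) <-> ~ D X.
Proof.
split=> [h1 h2|h]; last by case: (in_ultra_setVsetC X UD).
have : D (X `&` ~` X) by exact: filterI.
by rewrite setICr; exact: (@filter_not_empty _ D _).
Qed.

Lemma ultra_eqset (X Y Z : set I) : D Z -> (forall i, Z i -> X i <-> Y i) -> D X <-> D Y.
Proof.
by move=> hZ h; split=> hX; apply: filterS (filterI hZ hX) => i [h1 h2]; apply/h.
Qed.

Context (r : uname -> uname).
Hypothesis rE : forall f g, r f = r g <-> D [set i | uproj i f = uproj i g].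
Hypothesis rK : forall f, r (r f) = r f.

(** A tuple has finitely many coordinates, so this is a finite intersection of members of [D]. *)
Lemma ultra_repr n (t : n.-tuple uname) :
  D [set i | map_tuple (uproj i) (map_tuple r t) = map_tuple (uproj i) t].
Proof.
suff W (J : finType) (h : J -> uname) :
    D [set i | forall j, uproj i (r (h j)) = uproj i (h j)].
  apply: filterS (W _ (tnth t)) => i hi.
  by apply: eq_from_tnth => j; rewrite !tnth_map.
have [s hs] : exists s : seq J, forall j, j \in s by exists (enum J) => j; rewrite mem_enum.
suff W : D [set i | forall j, j \in s -> uproj i (r (h j)) = uproj i (h j)].
  by apply: filterS W => i hi j; exact: hi.
elim: s {hs} => [|j s IH]; first by apply: filterS (@filterT _ D _) => i _.
have hj : D [set i | uproj i (r (h j)) = uproj i (h j)] by apply/rE.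
apply: filterS (filterI hj IH) => i [h1 h2] k; rewrite inE => /orP[/eqP ->//|].
exact: h2.
Qed.

Lemma usym_r n (C : rsym L n) t : usym C (map_tuple r t) <-> usym C t.
Proof. by apply: (ultra_eqset (ultra_repr t)) => i /= ->. Qed.

Section Side.
Context (M : I -> henkin L U).
Hypothesis domE : forall i, dom (M i) = dom (A i).
Hypothesis cstE : forall i c, cstI (M i) c = cstI (A i) c.
Hypothesis symE : forall i n (C : rsym L n), symI (M i) C = symI (A i) C.

(** [M] stands for either family of the pair. Individuals are named through [A] in both cases, so
    the two ultraproducts have the same domain and differ only in the names of relations. *)
Definition urel n : Type := {K : I -> set (n.+1.-tuple U) | forall i, rels (M i) n (K i)}.

Definition Urel n (K : I -> set (n.+1.-tuple U)) (hK : forall i, rels (M i) n (K i)) :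
  urel n := exist _ K hK.

Definition uapp n (K : urel n) : set (n.+1.-tuple uname) :=
  [set t | D [set i | sval K i (map_tuple (uproj i) t)]].

Lemma uapp_r n (K : urel n) t : uapp K (map_tuple r t) <-> uapp K t.
Proof. by apply: (ultra_eqset (ultra_repr t)) => i /= ->. Qed.

Definition uasg (f : nat -> uname) (g : forall n, nat -> urel n) i : assignment U :=
  Assignment (fun x => uproj i (f x)) (fun n k => sval (g n k) i).

Lemma uasg_in f g i : assignment_in (M i) (uasg f g i).
Proof.
split=> [x|n k] /=; first by rewrite domE; exact: (proj2_sig (f x) i).
exact: (proj2_sig (g n k) i).
Qed.

Lemma uasg_nupd f g i x h : uasg (nupd f x h) g i = upd (uasg f g i) x (uproj i h).
Proof.
by apply: assignment_eq => //; apply: funext => y /=; rewrite /nupd; case: eqP.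
Qed.

Lemma uasg_nupdR f g i n k K :
  uasg f (nupdR g (n := n) k K) i = updR (uasg f g i) k (sval K i).
Proof.
apply: assignment_eq => // n' k' /=; rewrite /nupdR.
by case: dfwithP => [|j ne]; rewrite ?dfwith_in ?dfwith_out //; case: eqP.
Qed.

Lemma tval_uasg f g i t : tval (M i) (uasg f g i) t = uproj i (nval ucst f t).
Proof. by case: t => //= c; exact: cstE. Qed.

Lemma tvals_uasg f g i n (ts : n.-tuple (term L)) :
  map_tuple (tval (M i) (uasg f g i)) ts = map_tuple (uproj i) (map_tuple (nval ucst f) ts).
Proof. by apply: eq_from_tnth => j; rewrite !tnth_map tval_uasg. Qed.

(** Łoś's theorem in the form of truth clauses. Witnesses are chosen factor by factor, with an
    arbitrary value where the existential formula fails. *)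
Lemma ultra_tarski : tarski r ucst usym uapp (@eqfree L)
  (fun p f g => D [set i | sat (M i) (uasg f g i) p]).
Proof.
case=> [s t|n k l|n k ts|n C ts|q|q q'|x q|n k q] // ef f g.
- by rewrite rE /=; apply: (ultra_eqset filterT) => i _ /=; rewrite !tval_uasg.
- by apply: (ultra_eqset filterT) => i _ /=; rewrite tvals_uasg.
- by apply: (ultra_eqset filterT) => i _ /=; rewrite tvals_uasg symE.
- by split=> //; rewrite -ultra_not; apply: (ultra_eqset filterT) => i _.
- case/andP: ef => e1 e2; split=> //; split=> [h|[h1 h2]]; last exact: filterI.
  by split; apply: filterS h => i [].
- split=> //; split=> [h|[h hh]].
    have /choice[a ha] i : exists a, dom (A i) a /\
        (sat (M i) (uasg f g i) (FEx x q) -> sat (M i) (upd (uasg f g i) x a) q).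
      have [[a ha hs]|n] := pselect (sat (M i) (uasg f g i) (FEx x q)).
        by exists a; rewrite -domE.
      by have [a ha] := dom_neq0 (A i); exists a.
    exists (@Uname a (fun i => proj1 (ha i))).
    by apply: filterS h => i /(proj2 (ha i)); rewrite /= uasg_nupd.
  apply: filterS hh => i /=; rewrite uasg_nupd => hs.
  by exists (uproj i h) => //; rewrite domE; exact: (proj2_sig h i).
- split=> //; split=> [h|[K hh]].
    have /choice[a ha] i : exists a, rels (M i) n a /\
        (sat (M i) (uasg f g i) (FExR n k q) -> sat (M i) (updR (uasg f g i) k a) q).
      have [[a ha hs]|nn] := pselect (sat (M i) (uasg f g i) (FExR n k q)).
        by exists a.
      by have [a ha] := rels_neq0 (M i) n; exists a.
    exists (@Urel _ a (fun i => proj1 (ha i))).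
    by apply: filterS h => i /(proj2 (ha i)); rewrite /= uasg_nupdR.
  apply: filterS hh => i /=; rewrite uasg_nupdR => hs.
  by exists (sval K i) => //; exact: (proj2_sig K i).
Qed.

End Side.
End Ultraproduct.

(** The pairs are indexed by finite lists of formulas. The ultrafilter contains, for each formula,
    the set of lists in which it occurs, so each axiom of [T] holds in almost all pairs. *)
Lemma sigma_upward (L : signature) (T : set (form L)) (Q : form L) :
  extends_Sigma11_AC0 T -> upward_independent T Q -> sigma T (fun U A e => sat A e Q).
Proof.
move=> hAC up; apply: contrapT => nQ.
pose I := seq (form L).
have /choice[F hF] (s : I) : exists x : henkin L nat * henkin L nat * assignment nat,
    [/\ substructure x.1.1 x.1.2, dom x.1.1 = dom x.1.2, assignment_in x.1.1 x.2,
      sat x.1.1 x.2 Q /\ ~ sat x.1.2 x.2 Q &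
      forall p, p \in s -> T p -> valid x.1.1 p /\ valid x.1.2 p].
  by have [A [B [e h]]] := finite_pair hAC s nQ; exists (A, B, e).
pose A s := (F s).1.1; pose B s := (F s).1.2; pose e s := (F s).2.
(* This filter is generated by the sets of lists that include a given finite list; concatenation of
   lists accounts for intersections. *)
pose D0 : set_system I :=
  [set X | exists s0 : seq (form L), forall s : I, {subset s0 <= s} -> X s].
have D0F : ProperFilter D0.
  apply: Build_ProperFilter_ex => [X [s0 h]|]; first by exists s0; exact: h.
  split=> [|X Y [s hs] [s' hs']|X Y XY [s hs]]; first by exists [::].
    exists (s ++ s') => t ht; split; [apply: hs|apply: hs'] => p hp; apply: ht.
      by rewrite mem_cat hp.
    by rewrite mem_cat hp orbT.
  by exists s => t /hs/XY.
have [D [UD D0D]] := ultraFilterLemma D0F.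
have DT p : D [set s | p \in s].
  by apply: D0D; exists [:: p] => s; apply; rewrite mem_head.
have domE s : dom (B s) = dom (A s) by case: (hF s).
have cstE s c : cstI (B s) c = cstI (A s) c by case: (hF s) => -[].
(* The restriction to tuples over the domain of [A s] disappears because the two domains are
   equal. *)
have symE s n (C : rsym L n) : symI (B s) C = symI (A s) C.
  case: (hF s) => -[_ _ _ hC] _ _ _ _; rewrite -hC.
  apply/seteqP; split=> t => [ht|[]//]; split=> //.
  by rewrite -/(A s) -domE; exact: symI_sub ht.
have relAB s n R : rels (A s) n R -> rels (B s) n R.
  by case: (hF s) => -[_ h _ _] _ _ _ _; exact: h.
have [r [rE rK]] : exists r : uname A -> uname A,
    (forall f g, r f = r g <-> D [set i | uproj i f = uproj i g]) /\ (forall f, r (r f) = r f).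
  apply: representatives => [f|f g|f g h h1 h2].
  - by apply: filterS (@filterT _ D _) => i _.
  - by apply: filterS => i /= ->.
  - by apply: filterS (filterI h1 h2) => i [/= -> ->].
have he s : assignment_in (A s) (e s) by case: (hF s).
pose f0 x : uname A := Uname (f := fun s => ival (e s) x) (fun s => proj1 (he s) x).
pose gA n k : urel A n := Urel (K := fun s => rval (e s) n k) (fun s => proj2 (he s) n k).
pose toB n (K : urel A n) : urel B n :=
  Urel (K := sval K) (fun s => relAB _ _ _ (proj2_sig K s)).
pose gB n k : urel B n := toB n (gA n k).
pose sy := usym D (A := A).
have sy_r := usym_r UD rE rK.
have tA := ultra_tarski UD rE (fun _ => erefl) (fun _ _ => erefl) (fun _ _ _ => erefl).
have tB := ultra_tarski UD rE domE cstE symE.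
have aA n K t := @uapp_r L nat I D UD A r rE rK A n K t.
have aB n K t := @uapp_r L nat I D UD A r rE rK B n K t.
pose MA := truth_model (f0 0) (@ucst L nat I A) sy rK (fun n => gA n 0)
  (uapp D (A := A) (M := A)).
pose MB := truth_model (f0 0) (@ucst L nat I A) sy rK (fun n => gB n 0)
  (uapp D (A := A) (M := B)).
have sAB : substructure MA MB by apply: truth_substructure => n K; exists (toB n K).
have modA : model MA T.
  move=> p Tp; apply/valid_noeq; apply: (truth_valid sy_r aA tA (eqfree_noeq p)) => f g.
  apply: filterS (DT p) => s /= ps; apply: (proj2 (valid_noeq (A s) p)); last exact: uasg_in.
  by case: (hF s) => _ _ _ _ /(_ p ps Tp) [].
have modB : model MB T.
  move=> p Tp; apply/valid_noeq; apply: (truth_valid sy_r aB tB (eqfree_noeq p)) => f g.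
  apply: filterS (DT p) => s /= ps.
  apply: (proj2 (valid_noeq (B s) p)); last exact: (uasg_in domE).
  by case: (hF s) => _ _ _ _ /(_ p ps Tp) [].
have eEA s : uasg f0 gA s = e s by exact: assignment_eq.
have eEB s : uasg f0 gB s = e s by exact: assignment_eq.
pose eA := asg r (uapp D (A := A) (M := A)) f0 gA.
(* [toB] keeps the underlying family of sets, so both sides give the same extensions by
   computation. *)
have eAB : eA = asg r (uapp D (A := A) (M := B)) f0 gB by [].
have eAin : assignment_in MA eA by exact: asg_in.
have eBin : assignment_in MB eA by rewrite eAB; exact: asg_in.
have qA : sat MA eA Q.
  apply/sat_noeq => //; apply/(truth_lemma _ rK sy_r _ aA tA); first exact: eqfree_noeq.
  apply: filterS (@filterT _ D _) => s _ /=; apply/sat_noeq; first exact: uasg_in.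
  by rewrite eEA; case: (hF s) => _ _ _ [].
have : sat MB eA Q by exact: (up _ _ _ modA modB sAB).
move/(sat_noeq Q eBin); rewrite eAB.
move/(truth_lemma _ rK sy_r _ aB tB) => /(_ (eqfree_noeq Q)) h.
apply: (@filter_not_empty _ D _); apply: filterS h => s /=.
rewrite sat_noeq; last exact: (uasg_in domE).
by rewrite eEB; case: (hF s) => _ _ _ [].
Qed.

Theorem theorem8p1 (L : signature) (T : set (form L))
    (Rs : seq (nat * nat)) (Q : form L)
    (hT : theory T) (hAC : extends_Sigma11_AC0 T)
    (hQ : generalized_quantifier Rs Q) :
  (upward_independent T Q -> Sigma11_definable T Rs Q) /\
  (downward_independent T Q -> Pi11_definable T Rs Q) /\
  (domain_independent T Q -> Delta11_definable T Rs Q).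
Proof.
have up : upward_independent T Q -> Sigma11_definable T Rs Q.
  by move=> h; apply: sigma_definable => //; exact: sigma_upward.
have down : downward_independent T Q -> Pi11_definable T Rs Q.
  move=> h; apply: pi_definable => //; apply: sigma_upward => // U A B mA mB sAB e he /= nQ.
  by apply: contra_not nQ; exact: h.
by split=> //; split=> // -[hu hd]; split; [exact: up|exact: down].
Qed.
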